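(* Let $E$ be a real Banach space, let $S=\{S(t)\}_{t\ge 0}$ be a $C_0$-semigroup on $E$ with generator $A$, let $B$ be a bounded linear operator from a real Hilbert space $H$ into $E$, let $P$ be the associated Ornstein-Uhlenbeck semigroup and $P^\circ$ its restriction to $BUC^\circ(E)$. Suppose $t>s\ge 0$ are such that $$\|P^\circ(t)-P^\circ(s)\|_{\mathcal{L}(BUC^\circ(E))}<2.$$ Assume in addition that one of the following two assumptions is satisfied: (i) $\mu_{t-s}$ is nondegenerate; (ii) $P$ is strongly Feller at time $t-s$. Then there exists a direct sum decomposition into $S$-invariant subspaces $E=E_0\oplus E_1$, with $\dim E_1<\infty$, such that $S$ is nilpotent on $E_0$ and periodic on $E_1$ with period $t-s$.
   Context: Setting. $E^*$ is the dual of $E$; $Q:=BB^*\in\mathcal{L}(E^*,E)$ (with $H$ identified with its dual). For $t\ge 0$, $Q_t\in\mathcal{L}(E^*,E)$ is given by $\langle Q_tx^*,y^*\rangle=\int_0^t\langle S(s)BB^*S^*(s)x^*,y^*\rangle\,ds$ for $x^*,y^*\in E^*$. Standing assumption: for each $t\ge 0$ there is a centred Gaussian Radon measure $\mu_t$ on $E$ with covariance operator $Q_t$, i.e. a Radon probability measure under which every $x^*\in E^*$ is a centred Gaussian random variable with variance $\langle Q_tx^*,x^*\rangle$ (so $\mu_0=\delta_0$). The Ornstein-Uhlenbeck semigroup is $P(t)f(x)=\int_E f(S(t)x+y)\,d\mu_t(y)$ for $f\in C_b(E)$, the bounded real-valued continuous functions on $E$; the same formula is used for $f\in B_b(E)$,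 the bounded real-valued Borel functions on $E$. $BUC(E)$ is the space of bounded real-valued uniformly continuous functions on $E$ with the supremum norm; it is $P$-invariant. $BUC^\circ(E):=\{f\in BUC(E):\lim_{t\downarrow0}\|P(t)f-f\|=0\}$, a closed $P$-invariant subspace, and $P^\circ$ is the restriction of $P$ to it. $\mathcal{L}(X)$ carries the uniform operator norm. A Gaussian measure $\nu$ on $E$ is nondegenerate if there is no proper closed subspace $E'$ of $E$ with $\nu(E')=1$. $P$ is strongly Feller at time $\tau>0$ if $P(\tau)f\in C_b(E)$ for all $f\in B_b(E)$. ''$S$ is nilpotent on $E_0$'' means $S(t_0)|_{E_0}=0$ for some $t_0\ge 0$; ''periodic on $E_1$ with period $t-s$'' means $S(t-s)|_{E_1}=I|_{E_1}$. The direct sum is a topological one, with closed subspaces. *)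

(* Defs.v *)
From HB Require Import structures.
From mathcomp Require Import all_boot all_order all_algebra.
From mathcomp Require Import all_classical all_reals all_analysis.

Set Implicit Arguments.
Unset Strict Implicit.
Unset Printing Implicit Defensive.

Import Order.TTheory GRing.Theory Num.Theory.
Import numFieldTopology.Exports numFieldNormedType.Exports.

Local Open Scope classical_set_scope.
Local Open Scope ring_scope.

Definition borel (T : ptopologicalType) := g_sigma_algebraType (@open T).

Section Subspaces.
Context {R : realType} {E : normedModType R}.

Definition closed_subspace (V : set E) : Prop :=
  closed V /\ submod_closed [in V].

Definition finite_dimensional (V : set E) : Prop :=
  exists (n : nat) (b : 'I_n -> E),
    V = range (fun c : 'I_n -> R => \sum_(i < n) c i *: b i).

(* The direct sum is topological: the projection p onto E0 along E1 is
   continuous. *)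
Definition topological_direct_sum (E0 E1 : set E) : Prop :=
  [/\ closed_subspace E0, closed_subspace E1, E0 `&` E1 = [set 0] &
      exists p : {linear E -> E},
        continuous p /\ forall x, E0 (p x) /\ E1 (x - p x)].

End Subspaces.

Section Semigroups.
Context {R : realType} {E : normedModType R}.
Implicit Types (S : R -> {linear E -> E}) (V : set E).

(* Only the values S t with 0 <= t are constrained. *)
Record C0_semigroup S : Prop := {
  semigroup_bounded : forall t, 0 <= t -> continuous (S t) ;
  semigroup0 : forall x, S 0 x = x ;
  semigroupD : forall t s x, 0 <= t -> 0 <= s -> S (t + s) x = S t (S s x) ;
  semigroup_cvg0 : forall x, S t x @[t --> 0^'+] --> x }.

Definition semigroup_invariant S V : Prop :=
  forall t x, 0 <= t -> V x -> V (S t x).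

Definition nilpotent_on S V : Prop :=
  exists2 t0, 0 <= t0 & forall x, V x -> S t0 x = 0.

Definition periodic_on S V (p : R) : Prop := forall x, V x -> S p x = x.

End Semigroups.

Section Gaussian.
Context {R : realType} {E : normedModType R}.
Implicit Types (nu : probability (borel E) R).

Definition dual : set (E -> R) :=
  [set f | linear (f : E -> R^o) /\ continuous f].

(* For a finite Borel measure, Radon means inner regular with respect to
   compact sets on all Borel sets. *)
Definition radon nu : Prop :=
  forall A : set (borel E), measurable A -> forall e : R, 0 < e ->
    exists K : set E, [/\ compact K, K `<=` A & (nu (A `\` K) < e%:E)%E].

(* The library's [normal_prob] is not a Dirac mass when the standard deviation
   is 0. *)
Definition centred_normal (v : R) : set R -> \bar R :=
  if v == 0 then dirac (0 : R) else normal_prob 0 (Num.sqrt v).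

Definition centred_gaussian nu (Q : (E -> R) -> E) : Prop :=
  forall f, dual f -> forall A : set R, measurable A ->
    nu (f @^-1` A) = centred_normal (f (Q f)) A.

Definition nondegenerate_measure nu : Prop :=
  forall V : set E, closed_subspace V -> nu V = 1%E -> V = setT.

End Gaussian.

Section Covariance.
Context {R : realType} {E H : normedModType R}.
Variables (ip : H -> H -> R) (B : H -> E) (S : R -> {linear E -> E}).

(* B^* f, with H identified with its dual through ip: the Riesz representative
   of f \o B. *)
Definition adjoint (f : E -> R) : H :=
  xget 0 [set h | forall k, ip h k = f (B k)].

(* The operator Qt : E^* -> E is determined on E^* by its pairings with E^*;
   its linearity and boundedness follow.  S^*(s) f is f \o S s. *)
Definition is_covariance (t : R) (Qt : (E -> R) -> E) : Prop :=
  forall f g, dual f -> dual g ->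
    g (Qt f) =
    \int[lebesgue_measure]_(s in `[0, t]) g (S s (B (adjoint (f \o S s)))).

End Covariance.

Section FunctionSpaces.
Context {R : realType} {E : normedModType R}.
Implicit Types (f : E -> R) (X : set (E -> R)).

(* Norms are valued in \bar R, so that the suprema below are never the default
   value of a supremum of an unbounded set. *)
Definition supnorm f : \bar R := ereal_sup (range (fun x => `|f x|%:E)).

Definition opnorm X (T : (E -> R) -> E -> R) : \bar R :=
  ereal_sup [set supnorm (T f) | f in X `&` [set f | (supnorm f <= 1)%E]].

Definition Bb : set (E -> R) :=
  [set f | bounded_fun f /\ measurable_fun [set: borel E] (f : borel E -> R)].

Definition Cb : set (E -> R) := [set f | bounded_fun f /\ continuous f].

Definition BUC : set (E -> R) := [set f | bounded_fun f /\ unif_continuous f].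

End FunctionSpaces.

Section OrnsteinUhlenbeck.
Context {R : realType} {E : normedModType R}.
Variables (S : R -> {linear E -> E}) (mu : R -> probability (borel E) R).

Definition OU (t : R) (f : E -> R) (x : E) : R :=
  \int[mu t]_y f (S t x + (y : E)).

Definition strongly_Feller (t : R) : Prop := forall f, Bb f -> Cb (OU t f).

Definition BUCo : set (E -> R) :=
  [set f | BUC f /\ supnorm (OU t f \- f) @[t --> 0^'+] --> 0%E].

End OrnsteinUhlenbeck.

(* Main.v *)
(** Testing the difference of the two semigroup operators on clamped functions of
    finitely many functionals forces the finite-dimensional marginals of
    [N(S t x, Q t)] and [N(S s x, Q s)] to stay uniformly away from mutual
    singularity.  Such test functions need not be in [BUCo], but their averages
    [d^-1 \int_0^d f (S r x) dr] along orbits are, whatever the bounded cylindrical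
    Lipschitz function [f], and they converge to [f] pointwise.

    With one functional and [x] replaced by large multiples of [x] this gives
    [S t = S s].  Hence, for [p = t - s] and a multiple [N >= s] of [p], [S N] is a
    projection commuting with [S]; its kernel is [E0] and its range is [E1].

    On the functionals that are invariant under [S p] the covariances satisfy
    [Q t = Q s + Q p] and [Q s <= (k + 1) Q p] as soon as [s <= (k + 1) p], so that
    [Q s <= th Q t] with [th = (k + 1) / (k + 2) < 1], while each of the hypotheses
    (i) and (ii) makes [Q p] positive definite there.  If [E1] were
    infinite-dimensional, there would be arbitrarily many [Q t]-orthonormal
    invariant functionals [f_i].  Their exponential mean [1/n \sum_i exp f_i] has
    variance tending to 0 under both measures, expectation [exp (1/2)] under [mu t]
    and at most [exp (th / 2)] under [mu s], so it would separate the two measures,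
    a contradiction. Exponentials are used because all the moments involved then
    reduce to the one-dimensional laws of linear combinations of the [f_i]. *)

Require Import Defs.
From HB Require Import structures.
From mathcomp Require Import all_boot all_order all_algebra.
From mathcomp Require Import all_classical all_reals all_analysis.
From mathcomp Require Import measurable_realfun ring lra.

Set Implicit Arguments.
Unset Strict Implicit.
Unset Printing Implicit Defensive.

Import Order.TTheory GRing.Theory Num.Theory.
Import numFieldTopology.Exports numFieldNormedType.Exports.

Local Open Scope classical_set_scope.
Local Open Scope ring_scope.

(** * Exponential moments of Gaussian measures *)

Lemma borel_measurable_fun (R : realType) (T : ptopologicalType) (f : T -> R) :
  continuous f -> measurable_fun [set: borel T] (f : borel T -> R).
Proof.
move=> /continuousP cf; apply: (measurability _ (RGenOpens.measurableE R)).
move=> _ [_ [a [b ->] <-]]; rewrite setTI; apply: sub_sigma_algebra.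
exact/cf/interval_open.
Qed.

Section normal.
Context {R : realType}.
Notation mu := (@lebesgue_measure R).

(** The Radon-Nikodym density of the normal law has the same integral as [normal_pdf] over every
    measurable set, so the two agree almost everywhere and can be exchanged in the change of
    variables. *)
Lemma integral_normal_prob (m s : R) (g : R -> \bar R) :
  (forall x, 0 <= g x)%E -> measurable_fun [set: R] g ->
  (\int[normal_prob m s]_x g x = \int[mu]_x (g x * (normal_pdf m s x)%:E))%E.
Proof.
move=> g0 mg.
set f := Radon_Nikodym_SigmaFinite.f (normal_prob m s) mu.
have dom := normal_prob_dominates m s.
have fi : mu.-integrable setT f by exact: Radon_Nikodym_SigmaFinite.f_integrable.
rewrite -(Radon_Nikodym_SigmaFinite.change_of_variables dom g0)// -/f.
have mpdf : measurable_fun [set: R] (EFin \o normal_pdf m s).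
  by apply/measurable_EFinP; exact: measurable_normal_pdf.
apply: ae_eq_integral => //.
- by apply: emeasurable_funM => //; exact: measurable_int fi.
- exact: emeasurable_funM.
apply: ae_eqe_mul2l.
apply: integral_ae_eq => //.
- move=> A _ mA.
  by rewrite -(Radon_Nikodym_SigmaFinite.f_integral dom).
Qed.

Lemma normal_mgf (s : R) : s != 0 ->
  (\int[normal_prob 0 s]_x (expR x)%:E = (expR (s ^+ 2 / 2))%:E)%E.
Proof.
move=> s0; rewrite integral_normal_prob//; last first.
  by apply/measurable_EFinP; exact: measurable_expR.
under eq_integral => x _.
  (* Completing the square: tilting by [expR x] moves the mean from 0 to [s ^+ 2] and leaves a
     constant factor. *)
  rewrite -EFinM (_ : _ * _ = expR (s ^+ 2 / 2) * normal_pdf (s ^+ 2) s x); last first.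
    rewrite !normal_pdfE// mulrCA [RHS]mulrCA; congr (_ * _).
    rewrite /normal_fun -!expRD; congr expR; field; exact: s0.
  rewrite EFinM; over.
rewrite ge0_integralZl_EFin ?expR_ge0//.
- by rewrite integral_normal_pdf mule1.
- by move=> x _; rewrite lee_fin normal_pdf_ge0.
- by apply/measurable_EFinP; exact: measurable_normal_pdf.
Qed.

Lemma centred_normal_mgf (P : probability (measurableTypeR R) R) (v : R) : 0 <= v ->
  (forall A : set R, measurable A -> P A = centred_normal v A) ->
  (\int[P]_x (expR x)%:E = (expR (v / 2))%:E)%E.
Proof.
move=> v0; rewrite /centred_normal; have [->|vn0] := eqVneq v 0 => PE.
  rewrite (@eq_measure_integral _ _ _ _ (\d_(0 : measurableTypeR R))); last first.
    by move=> A mA _; exact: PE.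
  rewrite integral_dirac//; last by apply/measurable_EFinP; exact: measurable_expR.
  by rewrite diracT mul1e mul0r.
rewrite (@eq_measure_integral _ (measurableTypeR R) _ _ (normal_prob 0 (Num.sqrt v))); last first.
  by move=> A mA _; exact: PE.
by rewrite normal_mgf ?sqr_sqrtr// sqrtr_eq0 -ltNge lt_neqAle eq_sym vn0.
Qed.

Lemma gaussian_mgf (E : normedModType R) (nu : probability (borel E) R)
    (Q : (E -> R) -> E) (f : E -> R) :
  centred_gaussian nu Q -> dual f -> 0 <= f (Q f) ->
  (\int[nu]_x (expR (f x))%:E = (expR (f (Q f) / 2))%:E)%E.
Proof.
move=> gnu df q0; have mf : measurable_fun [set: borel E] (f : borel E -> measurableTypeR R).
  exact: borel_measurable_fun df.2.
pose f' : {mfun borel E >-> measurableTypeR R} :=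
  HB.pack (f : borel E -> measurableTypeR R) (isMeasurableFun.Build _ _ _ _ _ mf).
rewrite -(@centred_normal_mgf (distribution nu f') _ q0)//; last first.
  by move=> A mA; exact: gnu.
rewrite ge0_integral_pushforward//=.
  by apply/measurable_EFinP; exact: measurable_expR.
Qed.

End normal.

(** * Duality *)

Section dual.
Context {R : realType}.
Implicit Types E F : normedModType R.

Lemma continuous_linear_norm_bound E F (f : {linear E -> F}) : continuous f ->
  exists2 K, 0 < K & forall x, `|f x| <= K * `|x|.
Proof. by move/linear_bounded_continuous/linear_boundedP/pinfty_ex_gt0. Qed.

Lemma norm_bound_continuous_linear E F (f : {linear E -> F}) (K : R) :
  (forall x, `|f x| <= K * `|x|) -> continuous f.
Proof.
move=> fK; apply/linear_bounded_continuous/linear_boundedP.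
exists K; split; first exact: num_real.
by move=> M /ltW KM x; apply: (le_trans (fK x)); exact: ler_wpM2r.
Qed.

Let pack_linear E (f : E -> R^o) (lf : linear f) : {linear E -> R^o} :=
  HB.pack f (GRing.isLinear.Build _ _ _ _ _ lf).

Lemma dualP E (f : E -> R) : dual f -> exists g : {linear E -> R^o}, f = g.
Proof.
by case=> lf _; exists (pack_linear lf).
Qed.

Lemma dual0 E (f : E -> R) : dual f -> f 0 = 0.
Proof. by move=> /dualP[g ->]; rewrite raddf0. Qed.

Lemma dualD E (f : E -> R) : dual f -> {morph f : x y / x + y}.
Proof. by move=> /dualP[g ->] x y; rewrite raddfD. Qed.

Lemma dualB E (f : E -> R) : dual f -> {morph f : x y / x - y}.
Proof. by move=> /dualP[g ->] x y; rewrite raddfB. Qed.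

Lemma dualZ E (f : E -> R) a x : dual f -> f (a *: x) = a * f x.
Proof. by move=> /dualP[g ->]; rewrite linearZ. Qed.

Lemma dual_bound E (f : E -> R) : dual f ->
  exists2 K, 0 < K & forall x, `|f x| <= K * `|x|.
Proof.
move=> df; have [g fg] := dualP df.
have [|K K0 gK] := @continuous_linear_norm_bound E R^o g.
  by rewrite -fg; exact: df.2.
by exists K => // x; rewrite fg; exact: gK.
Qed.

Lemma bound_dual E (f : E -> R) K : linear (f : E -> R^o) ->
  (forall x, `|f x| <= K * `|x|) -> dual f.
Proof.
move=> lf fK; split => //.
exact: (@norm_bound_continuous_linear E R^o (pack_linear lf) K).
Qed.

Lemma dual_cst0 E : dual (fun=> 0 : R) (E := E).
Proof.
split; last exact: cst_continuous.
by move=> a x y; rewrite scaler0 addr0.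
Qed.

Lemma dual_lincomb E a (f g : E -> R) :
  dual f -> dual g -> dual (fun x => a * f x + g x).
Proof.
move=> df dg; split; last first.
  move=> x; apply: cvgD; last exact: dg.2.
  by apply: cvgM; [exact: cvg_cst|exact: df.2].
move=> b x y; rewrite (dualD df) (dualD dg) (dualZ _ _ df) (dualZ _ _ dg).
by rewrite /GRing.scale/=; ring.
Qed.

Lemma dual_comp E F (f : F -> R) (T : {linear E -> F}) :
  dual f -> continuous T -> dual (f \o T).
Proof.
move=> df cT; split; last first.
  by move=> x; apply: continuous_comp; [exact: cT|exact: df.2].
by move=> a x y; rewrite /= linearP dualD// dualZ.
Qed.

End dual.

Section riesz.
Context {R : realType} {H : completeNormedModType R}.
Variable ip : H -> H -> R.
Hypothesis ipC : forall u v, ip u v = ip v u.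
Hypothesis ipDl : forall u v w, ip (u + v) w = ip u w + ip v w.
Hypothesis ipZl : forall a u v, ip (a *: u) v = a * ip u v.
Hypothesis ip_norm : forall u, `|u| ^+ 2 = ip u u.

Let ipDr u v w : ip u (v + w) = ip u v + ip u w.
Proof. by rewrite ipC ipDl !(ipC u). Qed.

Let ipZr a u v : ip u (a *: v) = a * ip u v.
Proof. by rewrite ipC ipZl (ipC u). Qed.

Let normDZ (a : R) u v :
  `|u + a *: v| ^+ 2 = `|u| ^+ 2 + 2 * a * ip u v + a ^+ 2 * `|v| ^+ 2.
Proof. by rewrite !ip_norm !(ipDl, ipDr, ipZl, ipZr) (ipC v u); ring. Qed.

Lemma inner_cauchy_schwarz u v : `|ip u v| <= `|u| * `|v|.
Proof.
have [->|v0] := eqVneq v 0.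
  by rewrite -(scale0r (0 : H)) ipZr mul0r normr0 mulr_ge0.
have v2 : 0 < `|v| ^+ 2 by rewrite exprn_gt0// normr_gt0.
rewrite -ler_sqr ?nnegrE// ?mulr_ge0// real_normK ?num_real// exprMn.
have := sqr_ge0 `|u + (- ip u v / `|v| ^+ 2) *: v|.
rewrite normDZ -subr_ge0; move: v2; set c := `|v| ^+ 2 => c0 h.
rewrite (_ : _ - _ = (`|u| ^+ 2 + 2 * (- ip u v / c) * ip u v + (- ip u v / c) ^+ 2 * c) * c).
  by rewrite mulr_ge0// ltW.
by field; rewrite gt_eqF.
Qed.

Lemma riesz_representation (f : H -> R) : dual f ->
  exists h, forall k, ip h k = f k.
Proof.
move=> df; have [K K0 fK] := dual_bound df.
(* The representative minimizes [J]; minimizing sequences are Cauchy by the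
   parallelogram identity. *)
pose J h := `|h| ^+ 2 - 2 * f h.
have J_ge h : - K ^+ 2 <= J h.
  rewrite /J; have := fK h; have := sqr_ge0 (`|h| - K).
  by have := ler_norm (f h); nra.
have hJ : has_inf (range J).
  by split; [exists (J 0), 0|exists (- K ^+ 2) => _ [h _ <-]].
pose m := inf (range J).
have Jm h : m <= J h by apply: ge_inf; [exact: hJ.2|exists h].
pose e (n : nat) : R := n.+1%:R^-1.
have e0 n : 0 < e n by rewrite invr_gt0.
have /choice[h_ h_m] n : exists h, J h < m + e n ^+ 2.
  have [_ [h _ <-] Jh] := inf_adherent (exprn_gt0 2 (e0 n)) hJ.
  by exists h.
(* Approximate Euler equation: comparing [J (h_ n)] with [J] at [h_ n + a *: k] for [a = e n] and
   [a = - e n] bounds the first variation, because [h_ n] misses the infimum by less than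
   [e n ^+ 2]. *)
have h_d n k : `|ip (h_ n) k - f k| <= e n * (1 + `|k| ^+ 2).
  have key (a : R) : m <= J (h_ n) + 2 * a * (ip (h_ n) k - f k) + a ^+ 2 * `|k| ^+ 2.
    apply: (le_trans (Jm (h_ n + a *: k))).
    by rewrite /J normDZ (dualD df) (dualZ _ _ df); lra.
  have := key (e n); have := key (- e n); have := h_m n.
  have en := e0 n; set d := ip _ _ - _; set c := `|k| ^+ 2; set j := J _ => jm k1 k2.
  have c0 : 0 <= c by exact: sqr_ge0.
  rewrite ler_norml; apply/andP; split; rewrite -(ler_pM2l en); nra.
have h_diff n p : `|h_ n - h_ p| ^+ 2 <= 2 * e n ^+ 2 + 2 * e p ^+ 2.
  have := Jm (2^-1 *: h_ n + 2^-1 *: h_ p).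
  have := h_m n; have := h_m p; rewrite /J (dualD df) !(dualZ _ _ df).
  rewrite -(scaleN1r (h_ p)) !ip_norm !(ipDl, ipDr, ipZl, ipZr) (ipC (h_ p) (h_ n)).
  by lra.
have cvgh : cvg (h_ @ \oo).
  apply/cauchy_cvgP/cauchy_exP => eps eps0.
  have [N _ eN] : \forall n \near \oo, e n < eps / 4.
    have : e n @[n --> \oo] --> (0:R) by exact: cvg_harmonic.
    move/cvgrPdist_lt => /(_ (eps / 4)) []; first by rewrite divr_gt0.
    by move=> N _ NP; exists N => // n /NP; rewrite sub0r normrN gtr0_norm.
  exists (h_ N); exists N => // n /= Nn; rewrite -ball_normE/=.
  rewrite -ltr_sqr ?nnegrE ?(ltW eps0)//; apply: le_lt_trans (h_diff _ _) _.
  have := eN _ (leqnn N); have := eN _ Nn; have := e0 n; have := e0 N; nra.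
exists (lim (h_ @ \oo)) => k.
apply/eqP; rewrite -subr_eq0 -normr_le0; apply/ler_addgt0Pr => eps eps0; rewrite add0r.
have c0 : 0 < 1 + `|k| ^+ 2 by rewrite ltr_pwDl// sqr_ge0.
have k0 : 0 < 1 + `|k| by rewrite ltr_pwDl.
near \oo => n.
have A : e n * (1 + `|k| ^+ 2) <= eps / 2.
  rewrite -ler_pdivlMr//; near: n.
  have : e n @[n --> \oo] --> (0:R) by exact: cvg_harmonic.
  move/cvgrPdist_le => /(_ (eps / 2 / (1 + `|k| ^+ 2))) []; first by rewrite !divr_gt0.
  by move=> N _ NP; exists N => // n /NP; rewrite sub0r normrN gtr0_norm.
have B : `|lim (h_ @ \oo) - h_ n| <= eps / 2 / (1 + `|k|).
  near: n; move/cvgrPdist_le : cvgh; apply; by rewrite !divr_gt0.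
rewrite (_ : _ - _ = ip (lim (h_ @ \oo) - h_ n) k + (ip (h_ n) k - f k)); last first.
  by rewrite -(scaleN1r (h_ n)) ipDl ipZl; ring.
apply: (le_trans (ler_normD _ _)).
rewrite [leRHS](splitr eps) lerD//; last exact: le_trans (h_d n k) A.
apply: (le_trans (inner_cauchy_schwarz _ _)).
move: B; rewrite ler_pdivlMr// => B; apply: le_trans B.
by apply: ler_wpM2l => //; rewrite lerDr.
Unshelve. all: by end_near. Qed.

End riesz.

Section hahn_banach.
Context {R : realType} {E : normedModType R}.

(* Functionals of norm at most 1 on subspaces, encoded by their graphs; being
   bounded by the norm makes such a graph single-valued. *)
Let subfun (G : set (E * R)) : Prop :=
  (forall a p q, G p -> G q -> G (a *: p.1 + q.1, a * p.2 + q.2)) /\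
  (forall p, G p -> p.2 <= `|p.1|).

(** One-dimensional Hahn-Banach step. The value [c] at [x0] is the supremum of the lower bounds
    [p.2 - |p.1 - x0|]; the triangle inequality puts these below all upper bounds
    [|q.1 + x0| - q.2]. A general multiple [l *: x0] is reduced to these two cases by dividing by
    the absolute value of [l]. *)
Let subfun_extend (G : set (E * R)) (x0 : E) : subfun G -> G (0, 0) ->
  exists2 G', subfun G' & G `<=` G' /\ exists c, G' (x0, c).
Proof.
move=> [Glin Gle] G0.
pose A := [set p.2 - `|p.1 - x0| | p in G].
have A_ub q : G q -> ubound A (`|q.1 + x0| - q.2).
  move=> Gq _ [p Gp <-]; have := Gle _ (Glin 1 _ _ Gp Gq).
  rewrite /= scale1r mul1r => pq.
  have := ler_normD (p.1 - x0) (q.1 + x0); rewrite addrACA addNr addr0; lra.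
have supA : has_sup A.
  by split; [exists (0 - `|0 - x0|), (0, 0)|exists (`|0 + x0| - 0); exact: (A_ub (0, 0))].
pose c := sup A.
have c_ge p : G p -> p.2 - `|p.1 - x0| <= c.
  by move=> Gp; apply: sup_upper_bound => //; exists p.
have c_le q : G q -> c <= `|q.1 + x0| - q.2.
  by move=> Gq; apply: sup_le_ub; [exact: supA.1|exact: A_ub].
have GZ a p : G p -> G (a *: p.1, a * p.2).
  by move=> Gp; have := Glin a _ _ Gp G0; rewrite /= !addr0.
exists [set q | exists p l, G p /\ q = (p.1 + l *: x0, p.2 + l * c)]; split.
- move=> a _ _ [p [l [Gp ->]]] [q [k [Gq ->]]].
  exists (a *: p.1 + q.1, a * p.2 + q.2), (a * l + k).
  split; first exact: (Glin a).

  congr pair => /=; last by ring.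
  by rewrite scalerDr scalerDl scalerA addrACA.
- move=> _ [p [l [Gp ->]]] /=.
  have [l0|l0|->] := ltgtP l 0; last first.
  + by rewrite scale0r mul0r !addr0; exact: Gle.
  + have /c_le /= := GZ l^-1 _ Gp; move/(ler_wpM2l (ltW l0)).
    rewrite mulrBr mulrA divff ?gt_eqF// mul1r -[X in X * _ - _](gtr0_norm l0) -normrZ.
    by rewrite scalerDr scalerA divff ?gt_eqF// scale1r; lra.
  + have nl0 : 0 < - l by rewrite oppr_gt0.
    have /c_ge /= := GZ (- l)^-1 _ Gp; move/(ler_wpM2l (ltW nl0)).
    rewrite mulrBr mulrA divff ?gt_eqF// mul1r -[X in _ - X * _](gtr0_norm nl0) -normrZ.
    by rewrite scalerBr scalerA divff ?gt_eqF// scale1r scaleNr opprK; lra.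
- by move=> p Gp; exists p, 0; rewrite scale0r mul0r !addr0; case: p Gp.
- by exists c, (0, 0), 1; rewrite scale1r mul1r !add0r.
Qed.

Lemma hahn_banach_separation (z : E) : z != 0 -> exists2 f, dual f & f z != 0.
Proof.
move=> z0.
pose G0 : set (E * R) := [set p | exists a, p = (a *: z, a * `|z|)].
(* Adjoining the seed graph [G0] makes the empty union admissible, so Zorn's lemma applies to all
   chains, including the empty one. *)
pose P (G : set (E * R)) := subfun (G `|` G0).
have PG0 : subfun G0.
  split=> [a _ _ [b ->] [d ->]|_ [a ->]] /=.
    by exists (a * b + d); rewrite scalerDl scalerA mulrDl mulrA.
  by rewrite normrZ ler_wpM2r// ler_norm.
have [A [PA Amax]] : exists A, P A /\ forall B, A `<` B -> ~ P B.
  apply: Zorn_bigcup => F FP Ftot; split.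
    have step p q : (\bigcup_(X in F) X `|` G0) p -> (\bigcup_(X in F) X `|` G0) q ->
        exists2 X, (F X \/ X = set0) & (X `|` G0) p /\ (X `|` G0) q.
      move=> [[X FX Xp]|Gp] [[Y FY Yq]|Gq].
      - have [XY|YX] := Ftot _ _ FX FY.
          by exists Y; [left|split; left => //; exact: XY].
        by exists X; [left|split; left => //; exact: YX].
      - by exists X; [left|split; [left|right]].
      - by exists Y; [left|split; [right|left]].
      - by exists set0; [right|split; right].
    move=> a p q Up Uq; have [X [FX|X0] [Xp Xq]] := step p q Up Uq.
      have [h|h] := (FP _ FX).1 a _ _ Xp Xq; last by right.
        by left; exists X.
    move: Xp Xq; rewrite X0 !set0U => Gp Gq; right; exact: PG0.1.
  move=> p [[X FX Xp]|]; last exact: PG0.2.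
  by apply: (FP _ FX).2; left.
pose M := A `|` G0.
have M0 : M (0, 0) by right; exists 0; rewrite scale0r mul0r.
have dom x : exists r, M (x, r).
  (* An extension of [M] to [x] that were not already in [A] would contradict maximality. *)
  have [B Bsub [MB [c Bc]]] := subfun_extend x PA M0.
  exists c; apply: contrapT => nMc; apply: (Amax B).
    split; first by move=> p Ap; apply: MB; left.
    by move=> BA; apply: nMc; left; exact: BA.
  by rewrite /P (_ : B `|` G0 = B)//; apply/setUidPl => p Gp; apply: MB; right.
have [Mlin Mle] : subfun M by exact: PA.
have Muniq x r r' : M (x, r) -> M (x, r') -> r = r'.
  move=> h h'.
  have := Mle _ (Mlin (-1) _ _ h h'); have := Mle _ (Mlin (-1) _ _ h' h).
  by rewrite /= scaleN1r addNr normr0; lra.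
have [f Mf] := choice dom.
exists f; last first.
  have -> : f z = `|z| by apply: (Muniq z) => //; right; exists 1; rewrite scale1r mul1r.
  by rewrite normr_eq0.
have lf : linear (f : E -> R^o).
  by move=> a x y; apply: (Muniq (a *: x + y)) => //; exact: (Mlin a _ _ (Mf x) (Mf y)).
apply: (@bound_dual _ _ _ 1 lf) => x.
rewrite mul1r ler_norml; apply/andP; split; last exact: (Mle _ (Mf x)).
have := Mle _ (Mlin (-1) _ _ (Mf x) M0).
by rewrite /= !addr0 scaleN1r normrN; lra.
Qed.

End hahn_banach.

(** * Semigroups and covariances *)

Section semigroup.
Context {R : realType} {E : completeNormedModType R}.
Variable S : R -> {linear E -> E}.
Hypothesis S_C0 : C0_semigroup S.

Lemma semigroup_small_time (x : E) (e : R) : 0 < e ->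
  exists2 d : R, 0 < d & forall r : R, 0 <= r < d -> `|S r x - x| < e.
Proof.
move=> e0; have /cvgrPdist_lt/(_ e e0) := semigroup_cvg0 S_C0 (x := x).
move=> [d /= d0 Sd]; exists d => // r /andP[].
rewrite le_eqVlt => /predU1P[<- _|r0 rd].
  by rewrite (semigroup0 S_C0) subrr normr0.
by rewrite distrC; apply: Sd => //=; rewrite sub0r normrN gtr0_norm.
Qed.

(** Uniform boundedness principle. Otherwise there are times [p n] tending to 0 at which [S] has
    norm exceeding [n.+1]; yet each orbit stays bounded along these times, by continuity at 0 for
    late indices and by finiteness for the early ones. *)
Let bounded_near0 : exists2 d : R, 0 < d & exists2 M : R, 1 <= M &
  forall (r : R) (x : E), 0 <= r <= d -> `|S r x| <= M * `|x|.
Proof.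
apply: contrapT => nbd.
have /choice[p p_] (n : nat) : exists p : R * E,
    0 < p.1 < n.+1%:R^-1 /\ n.+1%:R * `|p.2| < `|S p.1 p.2|.
  apply: contrapT => np; apply: nbd; exists (n.+2%:R^-1); first by rewrite invr_gt0.
  exists n.+1%:R; first by rewrite ler1n.
  move=> r x /andP[r0 rn]; rewrite leNgt; apply/negP => Srx; apply: np.
  exists (r, x) => /=; split => //; apply/andP; split.
    rewrite lt_neqAle r0 andbT; apply/eqP => r0'; move: Srx; rewrite -r0'.
    by rewrite (semigroup0 S_C0) ltNge ler_peMl// ler1n.
  by rewrite (le_lt_trans rn)// ltf_pV2 ?posrE// ltr_nat.
pose F : set (E -> E) := range (fun n => S (p n).1 : E -> E).
have p1_ge0 n : 0 <= (p n).1 by have [/andP[/ltW]] := p_ n.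
have UF : uniform_bounded F.
  apply: Banach_Steinhauss.
    move=> _ [n _ <-]; split; last exact: linearP.
    have [K K0 SK] := continuous_linear_norm_bound (semigroup_bounded S_C0 (p1_ge0 n)).
    move=> r; exists (K * `|r|) => x xr; apply: (le_trans (SK x)).
    by rewrite ler_pM2l// (le_trans xr)// ler_norm.
  move=> x; have [d d0 Sd] := semigroup_small_time x ltr01.
  have [N dN] : exists N : nat, N.+1%:R^-1 < d.
    exists (Num.truncn d^-1); rewrite invf_plt ?posrE//; exact: truncnS_gt.
  exists (`|x| + 1 + \sum_(i < N) `|S (p i).1 x|) => _ [n _ <-].
  have [nN|Nn] := ltnP n N.
    apply: ler_wpDl; first by rewrite addr_ge0.
    rewrite (bigD1 (Ordinal nN))//= lerDl; exact: sumr_ge0.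
  rewrite -[leLHS]addr0; apply: lerD; last exact: sumr_ge0.
  rewrite -[S _ x](subrK x) (le_trans (ler_normD _ _))// addrC lerD2l ltW// Sd//.
  rewrite p1_ge0/=; have [/andP[_ h] _] := p_ n; apply: (lt_trans h).
  by apply: le_lt_trans dN; rewrite lef_pV2 ?posrE// ler_nat.
have [M FM] := UF 1.
have [n Mn] : exists n : nat, M < n.+1%:R by exists (Num.truncn M); exact: truncnS_gt.
have [/andP[pn0 _] pn] := p_ n.
have x0 : (p n).2 != 0.
  by apply/eqP => x0; move: pn; rewrite x0 raddf0 normr0 mulr0 ltxx.
have : `|S (p n).1 (`|(p n).2|^-1 *: (p n).2)| <= M.
  apply: (FM (S (p n).1)); first by exists n.
  by rewrite normrZ normfV normr_id mulVf ?normr_eq0.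
rewrite linearZ/= normrZ normfV normr_id ler_pdivrMl ?normr_gt0// leNgt => /negP; apply.
rewrite mulrC; apply: le_lt_trans pn; by apply: ler_wpM2r => //; exact: ltW.
Qed.

(** The bound near 0 is iterated over steps of length [d], of which [(Num.truncn (T / d)).+1] cover
    the interval up to [T]. *)
Lemma semigroup_locally_bounded (T : R) : exists2 M : R, 0 < M &
  forall (r : R) (x : E), 0 <= r <= T -> `|S r x| <= M * `|x|.
Proof.
have [d d0 [M M1 SM]] := bounded_near0.
have M0 : 0 < M by exact: lt_le_trans M1.
have SMn (n : nat) r x : 0 <= r <= n%:R * d -> `|S r x| <= M ^+ n * `|x|.
  elim: n r x => [|n IH] r x /andP[r0 rn].
    rewrite mul0r in rn; have -> : r = 0 by apply/eqP; rewrite eq_le rn r0.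
    by rewrite (semigroup0 S_C0) expr0 mul1r.
  have [rd|dr] := leP r d.
    apply: (le_trans (SM r x _)); first by rewrite r0.
    by rewrite ler_wpM2r// ler_eXnr.
  have rd0 : 0 <= r - d by rewrite subr_ge0 ltW.
  have -> : S r x = S d (S (r - d) x).
    by rewrite -(semigroupD S_C0) ?(ltW d0)// addrC subrK.
  apply: (le_trans (SM _ _ _)); first by rewrite lexx (ltW d0).
  rewrite exprS -mulrA ler_pM2l//; apply: IH; rewrite rd0/= lerBlDr.
  by apply: (le_trans rn); rewrite -natr1 mulrDl mul1r.
exists (M ^+ (Num.truncn (T / d)).+1); first by rewrite exprn_gt0.
move=> r x /andP[r0 rT]; apply: SMn; rewrite r0/= (le_trans rT)//.
by rewrite -ler_pdivrMr// ltW// truncnS_gt.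
Qed.

(** Nothing is assumed about [S] at negative times, so orbits are frozen there; this makes them
    continuous, hence measurable, on the whole line. Two-sided continuity follows by factoring out
    [S] at the smaller of two times, which is locally bounded. *)
Lemma semigroup_continuous (x : E) : continuous (fun r : R => S (Num.max 0 r) x).
Proof.
move=> r; apply/cvgrPdist_lt => e e0.
have [M M0 SM] := semigroup_locally_bounded (Num.max 0 r + 1).
have [d d0 Sd] := semigroup_small_time x (divr_gt0 e0 M0).
have key a b : 0 <= a <= b -> b <= Num.max 0 r + 1 -> b - a < d ->
    `|S a x - S b x| < e.
  move=> /andP[a0 ab] bT bad.
  have -> : S b x = S a (S (b - a) x).
    by rewrite -(semigroupD S_C0) ?subr_ge0// addrC subrK.
  rewrite -raddfB; apply: (le_lt_trans (SM _ _ _)); first by rewrite a0 (le_trans ab).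
  by rewrite mulrC -ltr_pdivlMr// distrC Sd// subr_ge0 ab.
near=> u.
have ru : `|r - u| < Num.min d 1.
  by near: u; apply: cvgr_dist_lt => //; rewrite lt_min d0 ltr01.
have {}ru : `|Num.max 0 r - Num.max 0 u| < Num.min d 1.
  apply: le_lt_trans ru.
  by have [r0|r0] := leP 0 r; have [u0|u0] := leP 0 u;
    rewrite ?subrr ?normr0// real_ler_norml ?num_real//;
    apply/andP; split; have := ler_norm (r - u); have := lerNnormlW (lexx `|r - u|); lra.
have m0 (v : R) : 0 <= Num.max 0 v by rewrite le_max lexx.
move: ru; rewrite lt_min => /andP[rud ru1].
have [h|/ltW h] := leP (Num.max 0 r) (Num.max 0 u).
  apply: key; rewrite ?m0//.
    by move: ru1; rewrite distrC ltr_norml; lra.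
  by apply: le_lt_trans rud; rewrite distrC ler_norm.
rewrite distrC; apply: key; rewrite ?m0 ?lerDl//.
by apply: le_lt_trans rud; rewrite ler_norm.
Unshelve. all: by end_near. Qed.

End semigroup.

Lemma bounded_on_by (R : realType) (T : Type) (f : T -> R) (A : set T) (M : R) :
  (forall x, A x -> `|f x| <= M) -> [bounded f x | x in A].
Proof.
move=> fM; exists M; split; first exact: num_real.
by move=> N /ltW MN x Ax; exact: le_trans (fM x Ax) MN.
Qed.

Section lebesgue.
Context {R : realType}.
Notation mu := (@lebesgue_measure R).

Lemma bounded_itv_integrable (g : R -> R) (a b M : R) (c d : bool) :
  measurable_fun [set: R] g -> (forall x, a <= x <= b -> `|g x| <= M) ->
  mu.-integrable [set` Interval (BSide c a) (BSide d b)] (EFin \o g).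
Proof.
move=> mg gM; apply: measurable_bounded_integrable => //.
- rewrite /= lebesgue_measure_itv/=; case: ifP => // _.
  by rewrite -EFinB ltry.
- exact: measurable_funTS.
- apply: (@bounded_on_by _ _ _ _ M) => x /=.
  rewrite itv_boundlr => /andP[ax xb]; apply: gM; apply/andP; split.
    by case: c ax; rewrite bnd_simp// => /ltW.
  by case: d xb; rewrite bnd_simp// => /ltW.
Qed.

(** Lebesgue measure is determined by its values on half-open intervals, and translation preserves
    their lengths. *)
Lemma lebesgue_measure_shift (c : R) (A : set R) : measurable A ->
  pushforward mu ((fun x => x + c) : _ -> measurableTypeR R) A = mu A.
Proof.
move=> mA; have mc : measurable_fun [set: measurableTypeR R] (fun x : R => x + c).
  exact: measurable_funD.
apply/esym/(@lebesgue_measure_unique _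
  (pushforward mu ((fun x => x + c) : _ -> measurableTypeR R))) => //= _ [[a b]] _ <-.
rewrite /pushforward/= (_ : _ @^-1` _ = `]a - c, b - c]%classic); last first.
  by apply/seteqP; split => x /=; rewrite !in_itv/= ltrBlDr lerBrDr.
rewrite !lebesgue_measure_itv/= !lte_fin ltrD2r; case: ifP => // _.
by rewrite -!EFinB; congr EFin; ring.
Qed.

Lemma Rintegral_shift (g : R -> R) (a b c M : R) :
  measurable_fun [set: R] g -> (forall x, a + c <= x <= b + c -> `|g x| <= M) ->
  \int[mu]_(x in `[a, b]) g (x + c) = \int[mu]_(x in `[a + c, b + c]) g x.
Proof.
move=> mg gM; rewrite /Rintegral.
pose phi : measurableTypeR R -> measurableTypeR R := fun x => x + c.
have mphi : measurable_fun setT phi by exact: measurable_funD.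
have pre : phi @^-1` `[a + c, b + c]%classic = `[a, b]%classic.
  by apply/seteqP; split => x /=; rewrite /phi !in_itv/= !lerD2r.
congr fine.
transitivity (\int[pushforward mu phi]_(y in `[(a + c)%R, (b + c)%R]) (g y)%:E)%E; last first.
  by apply: eq_measure_integral => A mA _; exact: lebesgue_measure_shift.
rewrite (@integral_pushforward _ _ _ _ _ _ mphi) ?pre//.
- exact/measurable_EFinP.
- apply: (@bounded_itv_integrable (fun x => g (x + c)) a b M).
    apply: (measurableT_comp mg); exact: measurable_funD.
  by move=> x xab; apply: gM; rewrite !lerD2r.
Qed.

Lemma Rintegral_cst_itv (a b K : R) : a <= b ->
  \int[mu]_(r in `[a, b]) K = K * (b - a).
Proof.
move=> ab; rewrite Rintegral_cst//= lebesgue_measure_itv/= lte_fin; congr (_ * _).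
case: ltP => [_|h0]; first by [].
by apply/eqP; rewrite eq_sym subr_eq0 eq_le ab h0.
Qed.

Lemma Rintegral_norm_itv_le (g : R -> R) (a b K : R) : a <= b ->
  measurable_fun [set: R] g -> (forall r, a <= r <= b -> `|g r| <= K) ->
  `|\int[mu]_(r in `[a, b]) g r| <= K * (b - a).
Proof.
move=> ab mg gK.
have ig : mu.-integrable `[a, b] (EFin \o g).
  exact: bounded_itv_integrable mg gK.
apply: (le_trans (le_normr_Rintegral _ ig)) => //.
rewrite -Rintegral_cst_itv//; apply: le_Rintegral => //.
- exact: integrable_norm.
- exact: (@bounded_itv_integrable (cst K) _ _ `|K|).
Qed.

End lebesgue.

Section inner.
Context {R : realType} {H : completeNormedModType R}.
Variable ip : {dot H for (idfun : R -> R)}.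

Lemma dotC u v : ip u v = ip v u.
Proof. by rewrite hermitian_subproof expr0 mul1r. Qed.

Lemma dotDl u v w : ip (u + v) w = ip u w + ip v w.
Proof. by rewrite linearDl. Qed.

Lemma dotZl a u v : ip (a *: u) v = a * ip u v.
Proof. by rewrite linearZl_LR. Qed.

End inner.

Section covariance.
Context {R : realType} {E H : completeNormedModType R}.
Variable ip : {dot H for (idfun : R -> R)}.
Hypothesis ip_norm : forall h : H, `|h| ^+ 2 = ip h h.
Variable S : R -> {linear E -> E}.
Hypothesis S_C0 : C0_semigroup S.
Variable B : {linear H -> E}.
Hypothesis B_continuous : continuous B.
Variable Q : R -> (E -> R) -> E.
Hypothesis Q_covariance : forall r : R, 0 <= r -> is_covariance ip B S r (Q r).
Implicit Types f g : E -> R.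
Local Notation adj := (adjoint ip B).

(** By Riesz representation the set from which [adjoint] chooses is inhabited, so its default value
    0 is not what is returned. *)
Lemma adjointP f : dual f -> forall k, ip (adj f) k = f (B k).
Proof.
move=> df; apply: (@xgetPex _ 0 [set h | forall k, ip h k = f (B k)]).
apply: (riesz_representation (@dotC _ _ ip) (@dotDl _ _ ip) (@dotZl _ _ ip) ip_norm).
exact: dual_comp.
Qed.

Lemma dual_semigroup f r : dual f -> 0 <= r -> dual (f \o S r).
Proof. by move=> df r0; apply: dual_comp => //; exact: semigroup_bounded. Qed.

Lemma covariance_sym f g r : 0 <= r -> dual f -> dual g -> g (Q r f) = f (Q r g).
Proof.
move=> r0 df dg; rewrite !(Q_covariance r0)//; apply: eq_Rintegral => s.
rewrite inE/= in_itv/= => /andP[s0 _].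
have dfs := dual_semigroup df s0; have dgs := dual_semigroup dg s0.
rewrite -[LHS](adjointP dgs (adj (f \o S s))) dotC.
exact: (adjointP dfs (adj (g \o S s))).
Qed.

(** The density in time of the variance of [f]: the integrand of the covariance on the diagonal,
    written as a square and frozen at negative times. *)
Definition cov_rate f (r : R) : R := `|adj (f \o S (Num.max 0 r))| ^+ 2.

Lemma covarianceE f r : 0 <= r -> dual f ->
  f (Q r f) = \int[lebesgue_measure]_(s in `[0, r]) cov_rate f s.
Proof.
move=> r0 df; rewrite (Q_covariance r0)//; apply: eq_Rintegral => s.
rewrite inE/= in_itv/= => /andP[s0 _].
rewrite /cov_rate (max_idPr s0) ip_norm (adjointP (dual_semigroup df s0)).
by [].
Qed.

Lemma cov_rate_ge0 f r : 0 <= cov_rate f r.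
Proof. exact: sqr_ge0. Qed.

Lemma covariance_ge0 f r : 0 <= r -> dual f -> 0 <= f (Q r f).
Proof.
by move=> r0 df; rewrite covarianceE//; apply: Rintegral_ge0 => x _; exact: cov_rate_ge0.
Qed.

(* [|a|^2] is the supremum over [k] of [2 <a, k> - |k|^2], and each of these
   expressions is continuous in time. *)
Lemma measurable_cov_rate f : dual f -> measurable_fun [set: R] (cov_rate f).
Proof.
move=> df; apply/measurable_EFinP; apply: lower_semicontinuous_measurable => r a.
have da u : dual (f \o S (Num.max 0 u)).
  by apply: dual_semigroup => //; rewrite le_max lexx.
rewrite lte_fin => ar; set k := adj (f \o S (Num.max 0 r)) in ar.
pose c u := 2 * f (S (Num.max 0 u) (B k)) - `|k| ^+ 2.
have cc : continuous c.
  move=> u; apply: cvgB; last exact: cvg_cst.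
  apply: cvgM; first exact: cvg_cst.
  apply: (cvg_comp (fun u => S (Num.max 0 u) (B k)) f); last exact: df.2.
  exact: semigroup_continuous.
have cr : c r = cov_rate f r.
  have e : ip k k = f (S (Num.max 0 r) (B k)) := adjointP (da r) k.
  by rewrite /c /cov_rate -/k ip_norm -e; ring.
exists [set u | a < c u].
  by move: (cc r) => /cvgr_gt; apply; rewrite cr.
move=> u /=; rewrite lte_fin => /lt_le_trans; apply.
have := adjointP (da u) k; rewrite /c /cov_rate; set l := adj _ => /= <-.
have := sqr_ge0 `|l - k|; rewrite !ip_norm -(scaleN1r k).
by rewrite !(dotDl, dotZl, dotC ip _ (_ + _), dotC ip _ (_ *: _)) (dotC ip k l); lra.
Qed.

Lemma adjoint_le : exists2 KB, 0 < KB &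
  forall f K, dual f -> 0 <= K -> (forall x, `|f x| <= K * `|x|) -> `|adj f| <= K * KB.
Proof.
have [KB KB0 BK] := continuous_linear_norm_bound B_continuous.
exists KB => // f K df K0 fK.
have [->|a0] := eqVneq (adj f) 0; first by rewrite normr0 mulr_ge0// ltW.
have an0 : 0 < `|adj f| by rewrite normr_gt0.
rewrite -(ler_pM2r an0) -expr2 ip_norm (adjointP df).
apply: (le_trans (ler_norm _)); apply: (le_trans (fK _)).
by rewrite -mulrA ler_wpM2l.
Qed.

Lemma cov_rate_bound f T : dual f ->
  exists2 C, 0 < C & forall r, r <= T -> cov_rate f r <= C.
Proof.
move=> df; have [K K0 fK] := dual_bound df.
have [KB KB0 adjK] := adjoint_le.
have [M M0 SM] := semigroup_locally_bounded S_C0 (Num.max 0 T).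
exists ((K * M * KB) ^+ 2); first by rewrite exprn_gt0// !mulr_gt0.
move=> r rT; have r0 : 0 <= Num.max 0 r by rewrite le_max lexx.
rewrite /cov_rate ler_sqr ?nnegrE//; last by rewrite !mulr_ge0// ltW.
apply: adjK; [exact: dual_semigroup|by rewrite mulr_ge0// ltW|].
move=> x; apply: (le_trans (fK _)); rewrite -mulrA ler_pM2l//; apply: SM.
by rewrite r0 ge_max !le_max lexx rT orbT.
Qed.

(** The rate of [f \o S r] at time [s] is the rate of [f] at time [r + s], which is bounded up to
    [T + 1]. The constant is thus uniform in [r], as needed when averaging along orbits. *)
Lemma covariance_small f T : 0 <= T -> dual f -> exists2 C, 0 < C &
  forall r h, 0 <= r <= T -> 0 <= h <= 1 ->
    (f \o S r) (Q h (f \o S r)) <= C * h.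
Proof.
move=> T0 df; have [C C0 fC] := cov_rate_bound (T + 1) df.
exists C => // r h /andP[r0 rT] /andP[h0 h1].
have dfr := dual_semigroup df r0.
rewrite covarianceE//.
have rateE s : 0 <= s -> cov_rate (f \o S r) s = cov_rate f (r + s).
  move=> s0; rewrite /cov_rate !(max_idPr _) ?addr_ge0//.
  by congr (`|adj _| ^+ 2); apply/funext => x /=; rewrite (semigroupD S_C0).
have -> : C * h = \int[lebesgue_measure]_(s in `[0, h]) C.
  by rewrite Rintegral_cst_itv// subr0.
apply: le_Rintegral => //.
- apply: (@bounded_itv_integrable _ _ _ _ C); first exact: measurable_cov_rate.
  move=> s /andP[s0 sh]; rewrite ger0_norm ?cov_rate_ge0// rateE// fC//.
  by rewrite lerD// (le_trans sh).
- by apply: (@bounded_itv_integrable _ (cst C) _ _ C) => // s _; rewrite /cst ger0_norm// ltW.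
- move=> s /=; rewrite in_itv/= => /andP[s0 sh]; rewrite rateE// fC//.
  by rewrite lerD// (le_trans sh).
Qed.

Let integrable_cov_rate f a b c d : dual f ->
  lebesgue_measure.-integrable [set` Interval (BSide c a) (BSide d b)] (EFin \o cov_rate f).
Proof.
move=> df; have [C C0 fC] := cov_rate_bound b df.
apply: (@bounded_itv_integrable _ _ _ _ C); first exact: measurable_cov_rate.
by move=> s /andP[_ sb]; rewrite ger0_norm ?cov_rate_ge0// fC.
Qed.

Lemma covariance_split f r s : 0 <= r <= s -> dual f ->
  f (Q s f) = f (Q r f) + \int[lebesgue_measure]_(u in `[r, s]) cov_rate f u.
Proof.
move=> /andP[r0 rs] df; rewrite !covarianceE ?(le_trans r0)//.
rewrite -(@Rintegral_itv_obnd_cbnd _ r); last exact: integrable_cov_rate.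
rewrite -(@Rintegral_itvB _ _ (BLeft 0)) ?bnd_simp//; last exact: integrable_cov_rate.
by rewrite addrC subrK.
Qed.

Lemma covariance_nondecreasing f r s : 0 <= r <= s -> dual f -> f (Q r f) <= f (Q s f).
Proof.
move=> rs df; rewrite (covariance_split rs df) lerDl.
by apply: Rintegral_ge0 => x _; exact: cov_rate_ge0.
Qed.

(** Invariance under [S p] makes the rate of [f] periodic with period [p], so the part of the
    integral after time [p] can be shifted back to start at 0. *)
Lemma covariance_periodic f p r : 0 <= p -> 0 <= r -> dual f -> f \o S p = f ->
  f (Q (r + p) f) = f (Q r f) + f (Q p f).
Proof.
move=> p0 r0 df fp; rewrite (@covariance_split _ p); last 2 first.
- by rewrite p0 lerDr.
- by [].
rewrite addrC; congr (_ + _); rewrite covarianceE//.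
have [C C0 fC] := cov_rate_bound (r + p) df.
rewrite -[X in `[X, _]]add0r -(@Rintegral_shift _ _ _ _ _ C); first last.
- by move=> s /andP[_ sb]; rewrite ger0_norm ?cov_rate_ge0// fC.
- exact: measurable_cov_rate.
apply: eq_Rintegral => s; rewrite inE/= in_itv/= => /andP[s0 _].
rewrite /cov_rate !(max_idPr _) ?addr_ge0//; congr (`|adj _| ^+ 2).
apply/funext => x /=; rewrite addrC (semigroupD S_C0)//.
by rewrite -[LHS]/((f \o S p) (S s x)) fp.
Qed.

Lemma covariance_period_multiple f p (n : nat) : 0 <= p -> dual f -> f \o S p = f ->
  f (Q (n%:R * p) f) = n%:R * f (Q p f).
Proof.
move=> p0 df fp; elim: n => [|n IH].
  by rewrite !mul0r covarianceE// set_itv1 Rintegral_set1.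
by rewrite -natr1 !mulrDl !mul1r covariance_periodic ?mulr_ge0// IH.
Qed.

End covariance.

(** * Cylindrical functions and their time averages *)

Section caratheodory.
Context {R : realType} d {T : measurableType d}.

Let measurable_truncn_level (c : R) (n : nat) : 0 < c ->
  measurable [set r : R | Num.truncn (c * r) = n].
Proof.
move=> c0; case: n => [|n].
  rewrite (_ : mkset _ = `]-oo, c^-1[%classic)//.
  apply/seteqP; split => r /=; rewrite in_itv/=.
    by move/eqP; rewrite -leqn0 truncn_le_nat -[c^-1]mulr1 ltr_pdivlMl.
  by rewrite -[c^-1]mulr1 ltr_pdivlMl// => h; apply/eqP; rewrite -leqn0 truncn_le_nat.
rewrite (_ : mkset _ = `[n.+1%:R / c, n.+2%:R / c[%classic)//.
apply/seteqP; split => r /=; rewrite in_itv/= ler_pdivrMr// ltr_pdivlMr// (mulrC r).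
  move=> e; have cr0 : 0 <= c * r.
    by apply: (le_trans ler01); rewrite -truncn_gt0 e.
  by rewrite -e truncn_le cr0 truncnS_gt.
by move=> /truncn_def.
Qed.

(* Discretizing the first variable writes [F] as a pointwise limit of functions
   that are jointly measurable. *)
Lemma measurable_fun_caratheodory (F : R -> T -> R) :
  (forall y, continuous (F ^~ y)) -> (forall r, measurable_fun setT (F r)) ->
  (forall r y, F r y = F (Num.max 0 r) y) ->
  measurable_fun [set: T * R] (fun z => F z.2 z.1).
Proof.
move=> cF mF F0.
pose a (m : nat) (r : R) := (Num.truncn (m.+1%:R * r))%:R / m.+1%:R : R.
apply: (@measurable_fun_cvg _ _ _ _ (fun m z => F (a m z.2) z.1)).
  move=> m _ A mA; rewrite setTI.
  rewrite (_ : _ @^-1` _ = \bigcup_n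
    ((F (n%:R / m.+1%:R) @^-1` A) `*` [set r | Num.truncn (m.+1%:R * r) = n])).
    apply: bigcup_measurable => n _; apply: measurableX.
      by rewrite -[X in measurable X]setTI; exact: mF.
    exact: measurable_truncn_level.
  apply/seteqP; split => [[y r] /= Fy|[y r] [n _ [/= Fy e]]] /=.
    by exists (Num.truncn (m.+1%:R * r)).
  by rewrite /a e.
move=> [y r] _ /=; rewrite F0.
apply: (cvg_comp (fun m => a m r) (F ^~ y)); last exact: cF.
apply/cvgrPdist_le => e e0.
have [N _ eN] : \forall n \near \oo, n.+1%:R^-1 <= e.
  have : (n.+1%:R^-1 : R) @[n --> \oo] --> (0:R) by exact: cvg_harmonic.
  move/cvgrPdist_le => /(_ e e0) [N _ NP]; exists N => // n /NP.
  by rewrite sub0r normrN gtr0_norm.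
exists N => // n /= Nn; apply: le_trans (eN _ Nn).
have n0 : 0 < n.+1%:R :> R by [].
have [r0|/ltW r0] := leP 0 r; last first.
  have -> : a n r = 0.
    rewrite /a; have -> : Num.truncn (n.+1%:R * r) = 0%N; last by rewrite mul0r.
    apply/eqP; rewrite -leqn0 truncn_le_nat; apply: le_lt_trans ltr01.
    by rewrite -(mulr0 n.+1%:R) ler_pM2l.
  by rewrite subrr normr0 invr_ge0.
have nr0 : 0 <= n.+1%:R * r by rewrite mulr_ge0.
have := truncnS_gt (n.+1%:R * r); have := truncn_le (n.+1%:R * r); rewrite nr0 => h1 h2.
have -> : r - a n r = (n.+1%:R * r - (Num.truncn (n.+1%:R * r))%:R) / n.+1%:R.
  by rewrite /a; field; rewrite gt_eqF.
rewrite ger0_norm ?divr_ge0 ?subr_ge0// -[leRHS]mul1r ler_pM2r ?invr_gt0//.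
by move: h2; rewrite -natr1; lra.
Qed.

End caratheodory.

Section cylindrical.
Context {R : realType}.

(** Increments are measured by finitely many functionals rather than by the norm, so that their
    integrals against a Gaussian measure reduce to one-dimensional moments. *)
Definition cylindrical_lipschitz {E : normedModType R} (f : E -> R) : Prop :=
  exists n, exists2 phi : 'I_n -> E -> R, (forall i, dual (phi i)) &
    forall x y, `|f x - f y| <= \sum_(i < n) `|phi i (x - y)|.

Lemma cylindrical_lipschitz_bound {E : normedModType R} (f : E -> R) :
  cylindrical_lipschitz f -> exists2 K, 0 < K & forall x y, `|f x - f y| <= K * `|x - y|.
Proof.
move=> [n [phi dphi fphi]].
have /choice[K K_] i : exists K, 0 < K /\ forall x, `|phi i x| <= K * `|x|.
  by have [K ? ?] := dual_bound (dphi i); exists K.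
exists (1 + \sum_i K i).
  by rewrite ltr_pwDl// sumr_ge0// => i _; rewrite ltW//; case: (K_ i).
move=> x y; apply: (le_trans (fphi x y)).
rewrite mulrDl ler_wpDl ?mul1r// mulr_suml; apply: ler_sum => i _.
by case: (K_ i).
Qed.

Lemma lipschitz_continuous {E F : normedModType R} (f : E -> F) (K : R) : 0 < K ->
  (forall x y, `|f x - f y| <= K * `|x - y|) -> continuous f.
Proof.
move=> K0 fK x; apply/cvgrPdist_le => e e0; near=> y.
apply: (le_trans (fK x y)); rewrite mulrC -ler_pdivlMr//.
by near: y; apply: cvgr_dist_le => //; rewrite divr_gt0.
Unshelve. all: by end_near. Qed.

Lemma lipschitz_unif_continuous {E : normedModType R} (f : E -> R) (K : R) : 0 < K ->
  (forall x y, `|f x - f y| <= K * `|x - y|) -> unif_continuous f.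
Proof.
move=> K0 fK; apply/unif_continuousP => e e0.
exists (e / K); first by rewrite /= divr_gt0.
move=> [x y] /=; rewrite -!ball_normE/= => xy.
by apply: (le_lt_trans (fK x y)); rewrite mulrC -ltr_pdivlMr.
Qed.

Context {E : completeNormedModType R}.
Variable S : R -> {linear E -> E}.
Hypothesis S_C0 : C0_semigroup S.
Implicit Types f : E -> R.

Definition time_average f (d : R) (x : E) : R :=
  d^-1 * \int[lebesgue_measure]_(r in `[0, d]) f (S (Num.max 0 r) x).

Section bounded_cylindrical.
Variable f : E -> R.
Hypothesis f_cyl : cylindrical_lipschitz f.
Hypothesis f1 : forall x, `|f x| <= 1.

Lemma cylindrical_orbit_continuous x : continuous (fun r : R => f (S (Num.max 0 r) x)).
Proof.
move=> r; have [K K0 fK] := cylindrical_lipschitz_bound f_cyl.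
apply: (cvg_comp (fun r => S (Num.max 0 r) x) f); last exact: lipschitz_continuous fK _.
exact: semigroup_continuous.
Qed.

Let measurable_orbit x : measurable_fun [set: R] (fun r : R => f (S (Num.max 0 r) x)).
Proof. by apply: continuous_measurable_fun; exact: cylindrical_orbit_continuous. Qed.

Let integrable_orbit x a b c c' : lebesgue_measure.-integrable
  [set` Interval (BSide c a) (BSide c' b)] (EFin \o (fun r : R => f (S (Num.max 0 r) x))).
Proof. by apply: (@bounded_itv_integrable _ _ _ _ 1). Qed.

Lemma time_average_le1 d x : 0 < d -> `|time_average f d x| <= 1.
Proof.
move=> d0; rewrite /time_average normrM gtr0_norm ?invr_gt0// ler_pdivrMl// mulr1.
have := @Rintegral_norm_itv_le _ _ 0 d 1 (ltW d0) (measurable_orbit x) (fun r _ => f1 _).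
by rewrite mul1r subr0.
Qed.

Lemma time_average_diff d x y K : 0 < d ->
  (forall r, 0 <= r <= d -> `|f (S r x) - f (S r y)| <= K) ->
  `|time_average f d x - time_average f d y| <= K.
Proof.
move=> d0 fK; rewrite /time_average -mulrBr -RintegralB//; try exact: integrable_orbit.
rewrite normrM gtr0_norm ?invr_gt0// ler_pdivrMl// mulrC.
rewrite -[X in _ * X]subr0; apply: Rintegral_norm_itv_le; first exact: ltW.
  exact: measurable_funB.
by move=> r /andP[r0 rd]; rewrite (max_idPr r0); apply: fK; rewrite r0.
Qed.

Lemma time_average_lipschitz d : 0 < d -> exists2 K, 0 < K &
  forall x y, `|time_average f d x - time_average f d y| <= K * `|x - y|.
Proof.
move=> d0; have [K K0 fK] := cylindrical_lipschitz_bound f_cyl.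
have [M M0 SM] := semigroup_locally_bounded S_C0 d.
exists (K * M); first by rewrite mulr_gt0.
move=> x y; apply: time_average_diff => // r rd.
by apply: (le_trans (fK _ _)); rewrite -mulrA ler_pM2l// -raddfB; exact: SM.
Qed.

(** The two averages run over [[h, d + h]] and [[0, d]] of the same orbit. They differ only by the
    end pieces, each of length [h], on which [f] is bounded by 1. *)
Lemma time_average_shift d h x : 0 < d -> 0 <= h <= d ->
  `|time_average f d (S h x) - time_average f d x| <= 2 * h / d.
Proof.
move=> d0 /andP[h0 hd]; rewrite /time_average -mulrBr normrM gtr0_norm ?invr_gt0//.
rewrite mulrC ler_pM2r ?invr_gt0//.
have -> : \int[lebesgue_measure]_(r in `[0, d]) f (S (Num.max 0 r) (S h x)) =
    \int[lebesgue_measure]_(r in `[h, d + h]) f (S (Num.max 0 r) x).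
  have := @Rintegral_shift _ _ 0 d h 1 (measurable_orbit x) (fun r _ => f1 _).
  rewrite add0r => <-.
  apply: eq_Rintegral => r; rewrite inE/= in_itv/= => /andP[r0 _].
  by rewrite !(max_idPr _) ?addr_ge0// (semigroupD S_C0).
have split_at a b c : a <= b -> b <= c ->
    \int[lebesgue_measure]_(r in `[a, c]) f (S (Num.max 0 r) x) =
    \int[lebesgue_measure]_(r in `[a, b]) f (S (Num.max 0 r) x) +
    \int[lebesgue_measure]_(r in `[b, c]) f (S (Num.max 0 r) x).
  move=> ab bc; rewrite -(@Rintegral_itv_obnd_cbnd _ b); last exact: integrable_orbit.
  have ac := le_trans ab bc.
  rewrite -(@Rintegral_itvB _ _ (BLeft a)) ?bnd_simp//.
  by rewrite addrC subrK.
rewrite (split_at h d) ?lerDl// (split_at 0 h d)//.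
rewrite (_ : _ - _ = \int[lebesgue_measure]_(r in `[d, (d + h)]) f (S (Num.max 0 r) x) -
   \int[lebesgue_measure]_(r in `[0, h]) f (S (Num.max 0 r) x)); last by ring.
apply: (le_trans (ler_normB _ _)); rewrite mulrDl mul1r.
have b a b : a <= b -> `|\int[lebesgue_measure]_(r in `[a, b]) f (S (Num.max 0 r) x)| <= b - a.
  by move=> ab; rewrite -[leRHS]mul1r; apply: Rintegral_norm_itv_le.
apply: lerD; first by apply: (le_trans (b _ _ _)); rewrite ?lerDl//; lra.
by apply: (le_trans (b _ _ _)); lra.
Qed.

Lemma time_average_cvg (x : E) (e : R) : 0 < e -> exists2 d0, 0 < d0 &
  forall d, 0 < d < d0 -> `|time_average f d x - f x| <= e.
Proof.
move=> e0; have /cvgrPdist_le /(_ e e0) := @cylindrical_orbit_continuous x 0.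
rewrite maxxx (semigroup0 S_C0) => -[d0 /= d00 fd0]; exists d0 => // d /andP[dp dd0].
have -> : f x = d^-1 * \int[lebesgue_measure]_(r in `[0, d]) f x.
  by rewrite Rintegral_cst_itv ?(ltW dp)// subr0 mulrC mulfK// gt_eqF.
rewrite /time_average -mulrBr -RintegralB//; first last.
- apply: (@bounded_itv_integrable _ (cst (f x)) _ _ 1) => // r _.
  exact: f1.
rewrite normrM gtr0_norm ?invr_gt0// ler_pdivrMl// mulrC.
rewrite -[X in _ * X]subr0; apply: Rintegral_norm_itv_le; first exact: ltW.
  exact: measurable_funB.
move=> r /andP[r0 rd]; rewrite distrC; apply: fd0.
by rewrite /= sub0r normrN ger0_norm// (le_lt_trans rd).
Qed.

End bounded_cylindrical.
End cylindrical.

Lemma bounded_probability_integrable (R : realType) d (T : measurableType d)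
    (P : probability T R) (g : T -> R) (K : R) :
  measurable_fun setT g -> (forall x, `|g x| <= K) -> P.-integrable setT (EFin \o g).
Proof.
move=> mg gK; apply: measurable_bounded_integrable => //.
  by rewrite /= probability_setT ltry.
by apply: (@bounded_on_by _ _ _ _ K) => x _.
Qed.

Lemma Rintegral_probability_cst (R : realType) d (T : measurableType d)
    (P : probability T R) (c : R) : \int[P]_x c = c.
Proof. by rewrite Rintegral_cst//= probability_setT mulr1. Qed.

(** * Averaged cylindrical functions under the Ornstein-Uhlenbeck semigroup *)

Section ou.
Context {R : realType} {E H : completeNormedModType R}.
Variable ip : {dot H for (idfun : R -> R)}.
Hypothesis ip_norm : forall h : H, `|h| ^+ 2 = ip h h.
Variable S : R -> {linear E -> E}.
Hypothesis S_C0 : C0_semigroup S.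
Variable B : {linear H -> E}.
Hypothesis B_continuous : continuous B.
Variable Q : R -> (E -> R) -> E.
Hypothesis Q_covariance : forall r : R, 0 <= r -> is_covariance ip B S r (Q r).
Variable mu : R -> probability (borel E) R.
Hypothesis mu_gaussian : forall r : R, 0 <= r -> centred_gaussian (mu r) (Q r).
Implicit Types f g : E -> R.

(** [Q r] is not given as a linear map in its functional argument; symmetry of the pairing moves the
    combination outside, where it can be evaluated. *)
Lemma covariance_lincomb r a f g : 0 <= r -> dual f -> dual g ->
  a * f (Q r (fun x => a * f x + g x)) + g (Q r (fun x => a * f x + g x)) =
  a ^+ 2 * f (Q r f) + 2 * a * f (Q r g) + g (Q r g).
Proof.
move=> r0 df dg; have dh := dual_lincomb a df dg.
have sym := covariance_sym ip_norm S_C0 B_continuous Q_covariance r0.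
rewrite -(sym _ _ df dh) -(sym _ _ dg dh) (sym _ _ df dg); ring.
Qed.

Lemma covarianceZ r a f : 0 <= r -> dual f ->
  a * f (Q r (fun x => a * f x)) = a ^+ 2 * f (Q r f).
Proof.
move=> r0 df; have := covariance_lincomb a r0 df (@dual_cst0 _ E).
rewrite (_ : (fun x => a * f x + 0) = fun x => a * f x); last first.
  by apply/funext => x; rewrite addr0.
rewrite addr0 => ->.
rewrite -(covariance_sym ip_norm S_C0 B_continuous Q_covariance r0 df (@dual_cst0 _ E)).
by rewrite mulr0 !addr0.
Qed.

Lemma dualMl a f : dual f -> dual (fun x => a * f x).
Proof.
move=> df; have := dual_lincomb a df (@dual_cst0 _ E).
by congr dual; apply/funext => x; rewrite addr0.
Qed.

Lemma mu_mgf r f : 0 <= r -> dual f ->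
  (\int[mu r]_x (expR (f x))%:E = (expR (f (Q r f) / 2))%:E)%E.
Proof.
move=> r0 df; apply: gaussian_mgf => //; first exact: mu_gaussian.
exact: (covariance_ge0 ip_norm S_C0 B_continuous Q_covariance).
Qed.

Let measurable_dual f : dual f -> measurable_fun [set: borel E] (f : borel E -> R).
Proof. by case=> _; exact: borel_measurable_fun. Qed.

(** Dividing [f] by [Num.sqrt h] brings its variance below [C], so both exponential moments are at
    most [expR (C / 2)]; undoing the scaling yields the order [Num.sqrt h]. *)
Lemma mu_abs_moment r f h C : 0 <= r -> dual f -> 0 < h -> f (Q r f) <= C * h ->
  (\int[mu r]_x `|f x|%:E <= (2 * Num.sqrt h * expR (C / 2))%:E)%E.
Proof.
(* [|u| <= k (exp (u / k) + exp (- u / k))] *)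
move=> r0 df h0 fC; set k := Num.sqrt h.
have k0 : 0 < k by rewrite sqrtr_gt0.
have mexp a : measurable_fun [set: borel E] (fun x : borel E => (expR (a * f x))%:E).
  apply/measurable_EFinP; apply: (measurableT_comp (@measurable_expR R)).
  by apply: measurable_dual; exact: dualMl.
apply: (@le_trans _ _ (\int[mu r]_x (k%:E *
    ((expR (k^-1 * f x))%:E + (expR (- k^-1 * f x))%:E)))%E).
  apply: ge0_le_integral => //.
  - by apply/measurable_EFinP; apply: measurableT_comp => //; exact: measurable_dual.
  - by apply: measurable_funeM; exact: emeasurable_funD.
  - move=> x _; rewrite -EFinD -EFinM lee_fin.
    set u := f x; rewrite -ler_pdivrMl//.
    have := expR_ge1Dx (k^-1 * u); have := expR_ge1Dx (- k^-1 * u).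
    have := expR_ge0 (k^-1 * u); have := expR_ge0 (- k^-1 * u).
    rewrite -[X in X * `|u|]gtr0_norm ?invr_gt0// -normrM mulNr.
    by have [z0|z0] := leP 0 (k^-1 * u); rewrite ?(ger0_norm z0) ?(ltr0_norm z0); lra.
rewrite ge0_integralZl_EFin//; [|by move=> x _; rewrite -EFinD lee_fin addr_ge0 ?expR_ge0|
  exact: emeasurable_funD|exact: ltW].
rewrite ge0_integralD//; try by move=> x _; rewrite lee_fin expR_ge0.
have half a : a ^+ 2 = h^-1 ->
    (\int[mu r]_x (expR (a * f x))%:E <= (expR (C / 2))%:E)%E.
  move=> a2; rewrite (mu_mgf r0 (dualMl a df)) lee_fin ler_expR ler_pM2r ?invr_gt0//.
  by rewrite covarianceZ// a2 mulrC ler_pdivrMr.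
have k2 : k^-1 ^+ 2 = h^-1 by rewrite exprVn sqr_sqrtr// ltW.
rewrite (_ : (2 * k * _)%:E = (k%:E * ((expR (C / 2))%:E + (expR (C / 2))%:E))%E).
  by rewrite lee_pmul2l// leeD// half// sqrrN.
by rewrite -EFinD -EFinM; congr EFin; ring.
Qed.

Section smoothing.
Variable f : E -> R.
Variables (n : nat) (phi : 'I_n -> E -> R).
Hypothesis dphi : forall i, dual (phi i).
Hypothesis f_phi : forall x y, `|f x - f y| <= \sum_(i < n) `|phi i (x - y)|.
Hypothesis f1 : forall x, `|f x| <= 1.
Variable d : R.
Hypothesis d0 : 0 < d.

Let f_cyl : cylindrical_lipschitz f. Proof. by exists n, phi. Qed.

(** At time [r >= 0], this bounds the change of [f \o S r] under translation by [y], uniformly in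
    the base point. *)
Let N (r : R) (y : E) : R := \sum_(i < n) `|phi i (S (Num.max 0 r) y)|.

Let phi_orbit_continuous i y : continuous (fun r : R => phi i (S (Num.max 0 r) y)).
Proof.
move=> r; apply: (cvg_comp (fun r => S (Num.max 0 r) y) (phi i)); last exact: (dphi i).2.
exact: semigroup_continuous.
Qed.

Let N_continuous y : continuous (N ^~ y).
Proof.
move=> r; rewrite /N.
pose F i := (fun r : R => `|phi i (S (Num.max 0 r) y)|).
rewrite (_ : (fun r => _) = \sum_(i < n) F i); last first.
  by apply/funext => u; rewrite fct_sumE.
elim/big_ind : _ => [|g h cg ch|i _].
- exact: cvg_cst.
- by apply: cvgD.
- by apply: cvg_norm; exact: phi_orbit_continuous.
Qed.

Let measurable_orbit_dual i r : 
  measurable_fun [set: borel E] (fun y : borel E => `|phi i (S (Num.max 0 r) y)|).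
Proof.
apply: measurableT_comp => //; apply: measurable_dual.
by apply: (dual_semigroup S_C0) => //; rewrite le_max lexx.
Qed.

Let measurable_N r : measurable_fun [set: borel E] (N r : borel E -> R).
Proof. by apply: measurable_sum => i; exact: measurable_orbit_dual. Qed.

Let N_ge0 r y : 0 <= N r y. Proof. exact: sumr_ge0. Qed.

Let G (z : borel E * measurableTypeR R) : \bar R :=
  (N z.2 z.1 * \1_(`[0, d]%classic) z.2)%:E.

Let measurable_G : measurable_fun [set: borel E * measurableTypeR R] G.
Proof.
apply/measurable_EFinP; apply: measurable_funM.
  apply: (@measurable_fun_caratheodory _ _ (borel E) N) => //.
  move=> r y; rewrite /N; have -> // : Num.max 0 (Num.max 0 r) = Num.max 0 r.
  by apply/max_idPr; rewrite le_max lexx.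
have m1 : measurable_fun [set: measurableTypeR R] (\1_(`[0, d]%classic) : measurableTypeR R -> R).
  exact: measurable_indic.
exact: (measurableT_comp m1 measurable_snd).
Qed.

Let W (y : E) : R := \int[lebesgue_measure]_(r in `[0, d]) N r y.

Let W_ge0 y : 0 <= W y.
Proof. by apply: Rintegral_ge0 => r _; exact: N_ge0. Qed.

Let N_bound y : exists K, forall r, 0 <= r <= d -> `|N r y| <= K.
Proof.
have /choice[K K_] i : exists K, 0 < K /\ forall x, `|phi i x| <= K * `|x|.
  by have [K ? ?] := dual_bound (dphi i); exists K.
have [M M0 SM] := semigroup_locally_bounded S_C0 d.
exists (\sum_(i < n) K i * (M * `|y|)) => r rd; rewrite ger0_norm//.
apply: ler_sum => i _; have [Ki0 Ki] := K_ i; apply: (le_trans (Ki _)).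
rewrite ler_pM2l//; have /andP[r0 _] := rd; rewrite (max_idPr r0); exact: SM.
Qed.

Let integrable_N y : lebesgue_measure.-integrable `[0, d] (EFin \o (N ^~ y)).
Proof.
have [K NK] := N_bound y; apply: (@bounded_itv_integrable _ _ _ _ K) => //.
by apply: continuous_measurable_fun; exact: N_continuous.
Qed.

Let WE y : (W y)%:E = (\int[lebesgue_measure]_r G (y, r))%E.
Proof.
rewrite /W /Rintegral fineK; last first.
  by apply: integrable_fin_num => //; exact: integrable_N.
rewrite integral_mkcond; apply: eq_integral => r _.
by rewrite epatch_indic /G/= EFinM.
Qed.

Let measurable_W : measurable_fun [set: borel E] (W : borel E -> R).
Proof.
apply/measurable_EFinP.
rewrite (_ : _ \o _ = fubini_F lebesgue_measure G); last by apply/funext => y; exact: WE.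
by apply: measurable_fun_fubini_tonelli_F => // z; rewrite lee_fin mulr_ge0.
Qed.

(** Tonelli's theorem exchanges the time and space integrals; at each fixed time the functionals
    [phi i \o S r] have variance of order [h], hence first absolute moment of order [Num.sqrt h]. *)
Let orbit_moment : exists2 C, 0 < C & forall h, 0 < h <= 1 ->
  (\int[mu h]_y (W y)%:E <= (C * Num.sqrt h)%:E)%E.
Proof.
have /choice[C C_] i : exists C, 0 < C /\ forall r h, 0 <= r <= d -> 0 <= h <= 1 ->
    (phi i \o S r) (Q h (phi i \o S r)) <= C * h.
  have [C ? ?] := covariance_small ip_norm S_C0 B_continuous Q_covariance (ltW d0) (dphi i).
  by exists C.
pose K := \sum_(i < n) 2 * expR (C i / 2).
have K0 : 0 <= K by apply: sumr_ge0 => i _; rewrite mulr_ge0 ?expR_ge0.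
(* The added 1 keeps the constant positive when there are no functionals, where [K = 0]. *)
exists ((K + 1) * d); first by rewrite mulr_gt0// ltr_wpDl.
move=> h /andP[h0 h1].
under eq_integral do rewrite WE.
rewrite (fubini_tonelli (m1 := mu h) G)//; last by move=> z; rewrite lee_fin mulr_ge0.
apply: (@le_trans _ _ (\int[lebesgue_measure]_r ((K * Num.sqrt h) * \1_(`[0, d]%classic) r)%:E)%E).
  apply: ge0_le_integral => //.
  - by move=> r _; apply: integral_ge0 => y _; rewrite lee_fin mulr_ge0.
  - have G0 z : (0 <= G z)%E by rewrite lee_fin mulr_ge0.
    exact: (measurable_fun_fubini_tonelli_G (m1 := mu h) G measurable_G G0).
  - by apply/measurable_EFinP; apply: measurable_funM => //; exact: measurable_indic.
  move=> r _; rewrite /G/= indicE; have [|] := boolP (r \in _); last first.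
    by move=> _; under eq_integral do rewrite mulr0; rewrite integral0 mulr0.
  rewrite inE/= in_itv/= => rd; have /andP[r0 _] := rd; rewrite mulr1.
  under eq_integral do rewrite mulr1 /N -sumEFin.
  rewrite ge0_integral_sum//; last first.
    by move=> i; apply/measurable_EFinP; exact: measurable_orbit_dual.
  rewrite mulr_suml -sumEFin; apply: lee_sum => i _.
  have [_ Ci] := C_ i; rewrite (max_idPr r0) -mulrAC.
  apply: (@mu_abs_moment _ (phi i \o S r)) => //; first exact: ltW.
    exact: (dual_semigroup S_C0).
  by apply: Ci; rewrite ?rd// (ltW h0).
under eq_integral do rewrite EFinM.
rewrite ge0_integralZl_EFin//; last 2 first.
- by apply/measurable_EFinP; exact: measurable_indic.
- by rewrite mulr_ge0.
rewrite integral_indic// setIT/= lebesgue_measure_itv/= lte_fin d0 oppr0 adde0 -EFinM.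
rewrite lee_fin mulrAC ler_pM2r ?sqrtr_gt0// ler_pM2r//; lra.
Qed.

Let A := time_average S f d.

Let A_W u y : `|A (u + y) - A u| <= d^-1 * W y.
Proof.
have int_orbit x : lebesgue_measure.-integrable `[0, d]
    (EFin \o (fun r : R => f (S (Num.max 0 r) x))).
  apply: (@bounded_itv_integrable _ _ _ _ 1) => //.
  by apply: continuous_measurable_fun; exact: (cylindrical_orbit_continuous S_C0 f_cyl).
have int_diff : lebesgue_measure.-integrable `[0, d]
    (EFin \o (fun r : R => f (S (Num.max 0 r) (u + y)) - f (S (Num.max 0 r) u))).
  apply: (@bounded_itv_integrable _ _ _ _ 2).
    by apply: measurable_funB; apply: continuous_measurable_fun;
      exact: (cylindrical_orbit_continuous S_C0 f_cyl).
  move=> r _; apply: (le_trans (ler_normB _ _)).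
  by rewrite -[2]/(1 + 1) lerD.
rewrite /A /time_average -mulrBr -RintegralB// normrM gtr0_norm ?invr_gt0//.
rewrite ler_pM2l ?invr_gt0//; apply: (le_trans (le_normr_Rintegral _ int_diff)) => //.
apply: le_Rintegral => //; first exact: integrable_norm.
move=> r _; apply: (le_trans (f_phi _ _)).
by rewrite -raddfB addrAC subrr add0r.
Qed.

Let ou_shift : exists2 C, 0 < C & forall h x, 0 < h <= 1 ->
  `|OU S mu h A x - A (S h x)| <= C * Num.sqrt h.
Proof.
have [C C0 WC] := orbit_moment.
exists (d^-1 * C); first by rewrite mulr_gt0// invr_gt0.
move=> h x h1.
have mAx : measurable_fun [set: borel E] (fun y : borel E => A (S h x + (y : E))).
  have [K K0 AK] := time_average_lipschitz S_C0 f_cyl f1 d0.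
  apply: borel_measurable_fun; apply: (lipschitz_continuous K0) => y y'.
  by apply: (le_trans (AK _ _)); rewrite opprD addrACA subrr add0r.
rewrite /OU -[X in _ - X](Rintegral_probability_cst (mu h)) -RintegralB//; last 2 first.
- by apply: (@bounded_probability_integrable _ _ _ _ _ 1) => // y; exact: time_average_le1.
- by apply: (@bounded_probability_integrable _ _ _ _ _ 1) => // y; exact: time_average_le1.
have mD : measurable_fun [set: borel E] (fun y : borel E => A (S h x + (y : E)) - A (S h x)).
  exact: measurable_funB.
rewrite -lee_fin EFin_normr_Rintegral//; last first.
  apply: (@bounded_probability_integrable _ _ _ _ _ 2) => // y.
  by apply: (le_trans (ler_normB _ _)); rewrite -[2]/(1 + 1) lerD//; exact: time_average_le1.
have mE := measurableT : measurable [set: borel E].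
apply: (le_trans (le_abse_integral _ mE _)); first exact/measurable_EFinP.
apply: (@le_trans _ _ (\int[mu h]_y ((d^-1)%:E * (W y)%:E))%E).
  apply: ge0_le_integral => //.
  - by apply: measurableT_comp => //; exact/measurable_EFinP.
  - by apply: measurable_funeM; exact/measurable_EFinP.
  - by move=> y _; rewrite -EFinM lee_fin; exact: A_W.
rewrite ge0_integralZl_EFin//; last 3 first.
- by move=> y _; rewrite lee_fin.
- exact/measurable_EFinP.
- by rewrite invr_ge0 ltW.
by rewrite -mulrA EFinM lee_pmul2l ?lte_fin ?invr_gt0//; exact: WC.
Qed.

(* [A \o S h] is within [2 h / d] of [A], uniformly in space, even when [f \o S h] is
   not close to [f]; the noise contributes [O(sqrt h)] because [f] is cylindrical. *)
Lemma time_average_BUCo : BUCo S mu (time_average S f d).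
Proof.
split.
  split; first by apply: (@bounded_on_by _ _ _ _ 1) => x _; exact: time_average_le1.
  have [K K0 AK] := time_average_lipschitz S_C0 f_cyl f1 d0.
  exact: lipschitz_unif_continuous K0 AK.
rewrite -/A; have [C C0 AC] := ou_shift.
pose K := C + 2 / d.
have K0 : 0 < K by rewrite addr_gt0// divr_gt0.
apply: (@squeeze_cvge _ _ _ _ (cst 0%E) _ (fun h => (K * Num.sqrt h)%:E)).
- near=> h; apply/andP; split.
    apply: (@le_trans _ _ (`|(OU S mu h A \- A) 0|%:E)); first by rewrite lee_fin.
    by apply: ereal_sup_ubound; exists 0.
  have h0 : 0 < h by near: h; exact: nbhs_right_gt.
  have h1 : h <= 1 by near: h; exact: nbhs_right_le.
  have hd : h <= d by near: h; exact: nbhs_right_le.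
  apply: ge_ereal_sup => _ [x _ <-]; rewrite lee_fin /=.
  rewrite -(subrKA (A (S h x))) (le_trans (ler_normD _ _))// mulrDl lerD//.
    by apply: AC; rewrite h0.
  apply: (le_trans (time_average_shift S_C0 f_cyl f1 x d0 _)); first by rewrite (ltW h0).
  rewrite mulrAC ler_wpM2l ?divr_ge0 ?(ltW d0)//.
  (* Since [h <= 1], the drift term of order [h] is absorbed into [Num.sqrt h]. *)
  rewrite -[leLHS](sqr_sqrtr (ltW h0)) expr2 ler_piMr//.
  by rewrite -[leRHS]sqrtr1 ler_wsqrtr.
- exact: cvg_cst.
- apply: cvg_EFin; first exact: nearW.
  rewrite -[X in _ --> X](mulr0 K); apply: cvgM; first exact: cvg_cst.
  rewrite -[X in _ --> X]sqrtr0; apply: cvg_at_right_filter.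
  exact: sqrt_continuous.
Unshelve. all: by end_near. Qed.

End smoothing.
End ou.

(** * Separation of the two measures *)

Section clamp.
Context {R : realType}.

Definition clamp (u : R) : R := Num.max (-1) (Num.min 1 u).

Let clampE u : (clamp u = 1 /\ 1 <= u) \/ (clamp u = -1 /\ u <= -1) \/
  (clamp u = u /\ -1 <= u <= 1).
Proof.
rewrite /clamp; case: (leP 1 u) => h.
  by left; split => //; apply/max_idPr; lra.
right; case: (leP (-1) u) => k; last by left; split => //; exact: ltW.
by right; split => //=; exact: ltW.
Qed.

Lemma clamp_norm_le1 u : `|clamp u| <= 1.
Proof. by rewrite ler_norml; case: (clampE u) => [[]|[[]|[]]] -> // ?; apply/andP; split; lra. Qed.

Lemma clamp_homo u v : u <= v -> clamp u <= clamp v.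
Proof.
by move=> uv; case: (clampE u) => [[]|[[]|[]]] -> hu; case: (clampE v) => [[]|[[]|[]]] -> hv; lra.
Qed.

Lemma clamp_lipschitz u v : `|clamp u - clamp v| <= `|u - v|.
Proof.
have := ler_norm (u - v); have := ler_norm (v - u); rewrite (distrC v u) => h1 h2.
rewrite ler_norml; case: (clampE u) => [[]|[[]|[]]] -> hu;
  by case: (clampE v) => [[]|[[]|[]]] -> hv; apply/andP; split; lra.
Qed.

Lemma clamp_ge1 u : 1 <= u -> clamp u = 1.
Proof. by move=> u1; rewrite /clamp (min_idPl u1) (max_idPr _)//; lra. Qed.

Lemma clamp_leN1 u : u <= -1 -> clamp u = -1.
Proof. by move=> u1; rewrite /clamp (min_idPr _) ?(max_idPl _)//; lra. Qed.

(** A Chernoff-type bound: with its mirror image below, it estimates the failure of a clamped affine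
    functional to equal 1 or -1 by Gaussian exponential moments. *)
Lemma clamp_expR_ge u : 1 - clamp u <= 2 * expR (1 - u).
Proof.
have [u1|u1] := leP 1 u; first by rewrite clamp_ge1// subrr mulr_ge0// expR_ge0.
have := clamp_norm_le1 u; rewrite ler_norml => /andP[c1 _].
have : 1 <= expR (1 - u) by rewrite -[leLHS]expR0 ler_expR; lra.
by lra.
Qed.

Lemma clamp_expR_le u : 1 + clamp u <= 2 * expR (1 + u).
Proof.
have [u1|u1] := leP u (-1); first by rewrite clamp_leN1// subrr mulr_ge0// expR_ge0.
have := clamp_norm_le1 u; rewrite ler_norml => /andP[_ c1].
have : 1 <= expR (1 + u) by rewrite -[leLHS]expR0 ler_expR; lra.
by lra.
Qed.

End clamp.

Section gap.
Context {R : realType} {E H : completeNormedModType R}.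
Variable ip : {dot H for (idfun : R -> R)}.
Hypothesis ip_norm : forall h : H, `|h| ^+ 2 = ip h h.
Variable S : R -> {linear E -> E}.
Hypothesis S_C0 : C0_semigroup S.
Variable B : {linear H -> E}.
Hypothesis B_continuous : continuous B.
Variable Q : R -> (E -> R) -> E.
Hypothesis Q_covariance : forall r : R, 0 <= r -> is_covariance ip B S r (Q r).
Variable mu : R -> probability (borel E) R.
Hypothesis mu_gaussian : forall r : R, 0 <= r -> centred_gaussian (mu r) (Q r).
Variables (s t : R).
Hypothesis s_ge0 : 0 <= s.
Hypothesis t_ge0 : 0 <= t.
Hypothesis norm_lt2 : (opnorm (BUCo S mu) (fun f => OU S mu t f \- OU S mu s f)%R
             < 2%:E)%E.
Implicit Types f g : E -> R.

Let measurable_translate f u : cylindrical_lipschitz f ->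
  measurable_fun [set: borel E] (fun y : borel E => f (u + (y : E))).
Proof.
move=> /cylindrical_lipschitz_bound[K K0 fK].
apply: borel_measurable_fun; apply: (lipschitz_continuous K0) => y y'.
by apply: (le_trans (fK _ _)); rewrite opprD addrACA subrr add0r.
Qed.

Let OU_time_average_cvg f r x : 0 <= r -> cylindrical_lipschitz f -> (forall x, `|f x| <= 1) ->
  OU S mu r (time_average S f (m.+1%:R^-1)) x @[m --> \oo] --> OU S mu r f x.
Proof.
move=> r0 fcyl f1; rewrite /OU; apply: fine_cvg.
have d0 m : 0 < m.+1%:R^-1 :> R by rewrite invr_gt0.
rewrite fineK; last first.
  apply: integrable_fin_num => //; apply: (@bounded_probability_integrable _ _ _ _ _ 1) => //.
  exact: measurable_translate.
apply: (@dominated_cvg _ _ _ _ _ _ _ _ (cst 1%E)) => //.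
- move=> m; apply/measurable_EFinP.
  have [K K0 AK] := time_average_lipschitz S_C0 fcyl f1 (d0 m).
  apply: borel_measurable_fun; apply: (lipschitz_continuous K0) => y y'.
  by apply: (le_trans (AK _ _)); rewrite opprD addrACA subrr add0r.
- move=> y _; apply: cvg_EFin; first exact: nearW.
  apply/cvgrPdist_le => e e0.
  have [d dp fd] := time_average_cvg S_C0 fcyl f1 (S r x + y) e0.
  have : (m.+1%:R^-1 : R) @[m --> \oo] --> (0:R) by exact: cvg_harmonic.
  move/cvgrPdist_lt => /(_ d dp) [N _ NP]; exists N => // m /NP.
  rewrite sub0r normrN gtr0_norm// => md /=; rewrite distrC; apply: fd.
  by rewrite d0.
- by apply: (@bounded_probability_integrable _ _ _ _ (cst 1) 1) => // y; rewrite normr1.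
- move=> m y _; rewrite lee_fin; exact: (time_average_le1 S_C0 fcyl f1).
Qed.

Lemma cylindrical_gap : exists2 c : R, c < 2 & forall f, cylindrical_lipschitz f ->
  (forall x, `|f x| <= 1) -> forall x, OU S mu t f x - OU S mu s f x <= c.
Proof.
move: norm_lt2; set X := opnorm _ _ => X2.
exists (Num.max 0 (fine X)).
  rewrite gt_max ltr0n/=; case: X X2 => [x|//|_] /=; first by rewrite lte_fin.
  by rewrite ltr0n.
move=> f fcyl f1 x.
pose u m := OU S mu t (time_average S f (m.+1%:R^-1)) x -
  OU S mu s (time_average S f (m.+1%:R^-1)) x.
have key m : u m <= Num.max 0 (fine X).
  have d0 : 0 < m.+1%:R^-1 :> R by rewrite invr_gt0.
  rewrite /u; set A := time_average _ _ _.
  have [n [phi dphi fphi]] := fcyl.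
  have AB : BUCo S mu A.
    exact: (time_average_BUCo ip_norm S_C0 B_continuous Q_covariance mu_gaussian dphi fphi f1 d0).
  have A1 : (supnorm A <= 1)%E.
    apply: ge_ereal_sup => _ [y _ <-]; rewrite lee_fin.
    exact: (time_average_le1 S_C0 fcyl f1).
  have : (`|OU S mu t A x - OU S mu s A x|%:E <= X)%E.
    apply: (@le_trans _ _ (supnorm (OU S mu t A \- OU S mu s A))).
      by apply: ereal_sup_ubound; exists x.
    by apply: ereal_sup_ubound; exists A.
  move=> h; rewrite le_max; apply/orP; right.
  apply: (le_trans (ler_norm _)).
  by move: X2 h; case: X => //= r _; rewrite lee_fin.
have c12 : u @ \oo --> OU S mu t f x - OU S mu s f x.
  by apply: cvgB; exact: OU_time_average_cvg.
rewrite -(cvg_lim (@Rhausdorff R) c12); apply: limr_le; last by apply: nearW => m; exact: key.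
by apply/cvg_ex; eexists; exact: c12.
Qed.

(** A function close to 1 under one measure and to -1 under the other would make the gap at least
    [2 - U - V], which is impossible once [U + V < 2 - c]. *)
Lemma cylindrical_not_separated : exists2 e : R, 0 < e & forall f, cylindrical_lipschitz f ->
  (forall x, `|f x| <= 1) -> forall (x : E) (U V : R),
  (\int[mu t]_y (1 - f (S t x + (y : E)))%:E <= U%:E)%E ->
  (\int[mu s]_y (1 + f (S s x + (y : E)))%:E <= V%:E)%E -> e <= U + V.
Proof.
have [c c2 fc] := cylindrical_gap.
exists (2 - c); first by rewrite subr_gt0.
move=> f fcyl f1 x U V hU hV; have fx := fc f fcyl f1 x.
have intf r u : (mu r).-integrable [set: borel E] (EFin \o (fun y : borel E => f (u + (y : E)))).
  by apply: (@bounded_probability_integrable _ _ _ _ _ 1) => //; exact: measurable_translate.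
have int1 r : (mu r).-integrable [set: borel E] (EFin \o (cst 1 : borel E -> R)).
  by apply: (@bounded_probability_integrable _ _ _ _ _ 1) => // y; rewrite normr1.
have U' : 1 - OU S mu t f x <= U.
  rewrite /OU -[X in X - _](Rintegral_probability_cst (mu t)) -RintegralB//;
    [|exact: int1|exact: intf].
  rewrite -lee_fin /Rintegral fineK//; apply: integrable_fin_num => //.
  by have := integrableB measurableT (int1 t) (intf t (S t x)); apply.
have V' : 1 + OU S mu s f x <= V.
  rewrite /OU -[X in X + _](Rintegral_probability_cst (mu s)) -RintegralD//;
    [|exact: int1|exact: intf].
  rewrite -lee_fin /Rintegral fineK//; apply: integrable_fin_num => //.
  by have := integrableD measurableT (int1 s) (intf s (S s x)); apply.
by lra.
Qed.

Lemma semigroup_agree x : S t x = S s x.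
Proof.
apply/eqP; rewrite -subr_eq0; apply/negPn/negP => /hahn_banach_separation[phi dphi].
rewrite dualB//; set a := phi (S t x); set b := phi (S s x) => ab0.
(* With this factor, and after recentring at the midpoint, the functional [F] below has means [M]
   and [- M] when started from [M *: x], while its fluctuation [k * phi y] does not depend on
   [M]. *)
pose k := 2 / (a - b).
have [e e0 He] := cylindrical_not_separated.
have dk := dualMl k dphi.
pose Ct := expR (- k * phi (Q t (fun x => - k * phi x)) / 2).
pose Cs := expR (k * phi (Q s (fun x => k * phi x)) / 2).
pose K := 2 * expR 1 * (Ct + Cs).
have K0 : 0 < K by rewrite !mulr_gt0 ?addr_gt0 ?expR_gt0.
(* The two errors add up to [K / expR M], and [expR M >= M > K / e] makes this smaller than [e]. *)
have [m mK] : exists m : nat, K / e < m.+1%:R by exists (Num.truncn (K / e)); exact: truncnS_gt.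
pose M : R := m.+1%:R.
pose F z := k * phi z - k * M * (a + b) / 2.
have Ft y : F (S t (M *: x) + y) = M + k * phi y.
  rewrite /F (dualD dphi) linearZ (dualZ _ _ dphi) -/a /k; field; exact: ab0.
have Fs y : F (S s (M *: x) + y) = - M + k * phi y.
  rewrite /F (dualD dphi) linearZ (dualZ _ _ dphi) -/b /k; field; exact: ab0.
have Fcyl : cylindrical_lipschitz (clamp \o F).
  exists 1%N, (fun _ z => k * phi z) => // z z'; rewrite big_ord1.
  apply: (le_trans (clamp_lipschitz _ _)).
  by rewrite /F (dualB dphi) opprB addrA subrK mulrBr.
have mexp l : measurable_fun [set: borel E] (fun y : borel E => (expR (l * phi y))%:E).
  apply/measurable_EFinP; apply: (measurableT_comp (@measurable_expR R)).
  by apply: borel_measurable_fun; exact: (dualMl l dphi).2.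
have mclamp c u :
    measurable_fun [set: borel E] (fun y : borel E => c + (clamp \o F) (u + (y : E))).
  by apply: measurable_funD => //; exact: measurable_translate.
have mNclamp c u :
    measurable_fun [set: borel E] (fun y : borel E => c - (clamp \o F) (u + (y : E))).
  by apply: measurable_funB => //; exact: measurable_translate.
have cn (u : R) := clamp_norm_le1 u.
have := He _ Fcyl (fun z => clamp_norm_le1 _) (M *: x)
  (2 * expR (1 - M) * Ct) (2 * expR (1 - M) * Cs).
have -> : (e <= 2 * expR (1 - M) * Ct + 2 * expR (1 - M) * Cs) = false.
  apply/negbTE; rewrite -ltNge -mulrDr expRB.
  rewrite (_ : _ * _ = K / expR M); last by rewrite /K; ring.
  rewrite ltr_pdivrMr ?expR_gt0//; move: mK; rewrite ltr_pdivrMr// mulrC => /lt_le_trans; apply.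
  by rewrite ler_pM2l// (le_trans _ (expR_ge1Dx _))// lerDr.
have bound r l c : 0 <= r ->
  (\int[mu r]_y ((2 * expR c)%:E * (expR (l * phi y))%:E) =
    (2 * expR c * expR (l * phi (Q r (fun x => l * phi x)) / 2))%:E)%E.
  move=> r0; rewrite ge0_integralZl_EFin ?mulr_ge0 ?expR_ge0//.
  by rewrite (mu_mgf ip_norm S_C0 B_continuous Q_covariance mu_gaussian r0 (dualMl l dphi)).
move=> h; suff: false by []; apply: h.
- rewrite -bound//; apply: ge0_le_integral => //.
  + by move=> y _; rewrite lee_fin; have := cn (F (S t (M *: x) + y)); rewrite ler_norml /=; lra.
  + by apply/measurable_EFinP; exact: mNclamp.
  + exact: measurable_funeM.
  + move=> y _; rewrite -EFinM lee_fin -mulrA -expRD /= Ft.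
    by apply: (le_trans (clamp_expR_ge _)); rewrite opprD addrA mulNr.
- rewrite -bound//; apply: ge0_le_integral => //.
  + by move=> y _; rewrite lee_fin; have := cn (F (S s (M *: x) + y)); rewrite ler_norml /=; lra.
  + by apply/measurable_EFinP; exact: mclamp.
  + exact: measurable_funeM.
  + move=> y _; rewrite -EFinM lee_fin -mulrA -expRD /= Fs.
    by apply: (le_trans (clamp_expR_le _)); rewrite addrA.
Qed.

End gap.

(** * Orthonormal families of functionals *)

(** Induction on [n]: the kernel in [V] of the last functional is separated by the remaining ones,
    and it has codimension at most 1, so at most one basis vector [v] is added. *)
Lemma finite_dimensional_separated (R : realType) (E : normedModType R) (n : nat)
    (f : nat -> E -> R) (V : set E) :
  (forall i, dual (f i)) -> V 0 ->
  (forall a x y, V x -> V y -> V (a *: x + y)) ->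
  (forall z, V z -> (forall i, (i < n)%N -> f i z = 0) -> z = 0) ->
  finite_dimensional V.
Proof.
move=> df; elim: n V => [|n IH] V V0 Vlin Vsep.
  exists 0%N, (fun=> 0); apply/seteqP; split => [z Vz|_ [c _ <-]].
    by exists (fun=> 0) => //; rewrite big_ord0 (Vsep z).
  by rewrite big_ord0.
pose V' := [set z | V z /\ f n z = 0].
have [m [b V'E]] : finite_dimensional V'.
  apply: IH => [|a x y [Vx fx] [Vy fy]|z [Vz fz] zn].
  - by split => //; exact: dual0.
  - by split; [exact: Vlin|rewrite (dualD (df n)) (dualZ _ _ (df n)) fx fy mulr0 addr0].
  - by apply: Vsep => // i; rewrite ltnS leq_eqVlt => /predU1P[->|/zn].
have [[v [Vv fv]]|nov] := pselect (exists v, V v /\ f n v != 0); last first.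
  exists m, b; rewrite -V'E; apply/seteqP; split => [z Vz|z []//].
  by split => //; apply/eqP/negPn/negP => fz; apply: nov; exists z.
exists m.+1, (fun i => oapp b v (unlift ord0 i)).
have sumE (c : 'I_m.+1 -> R) : \sum_(i < m.+1) c i *: oapp b v (unlift ord0 i) =
    c ord0 *: v + \sum_(i < m) c (lift ord0 i) *: b i.
  by rewrite big_ord_recl unlift_none; congr (_ + _); apply: eq_bigr => i _; rewrite liftK.
apply/seteqP; split => [z Vz|_ [c _ <-]]; last first.
  rewrite sumE; apply: Vlin => //.
  have : V' (\sum_(i < m) c (lift ord0 i) *: b i).
    by rewrite V'E; exists (fun i => c (lift ord0 i)).
  by case.
have : V' (- (f n z / f n v) *: v + z).
  split; first exact: Vlin.
  by rewrite (dualD (df n)) (dualZ _ _ (df n)) mulNr divfK// addNr.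
rewrite V'E => -[c _ cE].
exists (fun i => oapp c (f n z / f n v) (unlift ord0 i)) => //.
rewrite sumE unlift_none/=.
under eq_bigr do rewrite liftK /=.
by rewrite cE addrA -scalerDl subrr scale0r add0r.
Qed.

Lemma dual_sum (R : realType) (E : normedModType R) (n : nat) (c : nat -> R)
    (f : nat -> E -> R) : (forall i, (i < n)%N -> dual (f i)) ->
  dual (fun x => \sum_(i < n) c i * f i x).
Proof.
elim: n => [|n IH] df.
  by have := @dual_cst0 R E; congr dual; apply/funext => x; rewrite big_ord0.
have := dual_lincomb (c n) (df _ (ltnSn n)) (IH (fun i ni => df _ (ltnW ni))).
by congr dual; apply/funext => x; rewrite big_ord_recr/= addrC.
Qed.

Section gram_schmidt.
Context {R : realType} {E : normedModType R}.
Variable Q : (E -> R) -> E.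
Hypothesis Q_sym : forall f g, dual f -> dual g -> g (Q f) = f (Q g).
Variable F : set (E -> R).
Hypothesis F_dual : forall f, F f -> dual f.
Hypothesis F_lincomb : forall a f g, F f -> F g -> F (fun x => a * f x + g x).
Hypothesis F0 : F (fun=> 0).
Hypothesis Q_gt0 : forall f x, F f -> f x != 0 -> 0 < f (Q f).
Hypothesis F_large : forall n (f : nat -> E -> R), (forall i, dual (f i)) ->
  exists2 z, (forall i, (i < n)%N -> f i z = 0) & exists2 g, F g & g z != 0.

Let F_sum n (c : nat -> R) (f : nat -> E -> R) : (forall i, (i < n)%N -> F (f i)) ->
  F (fun x => \sum_(i < n) c i * f i x).
Proof.
elim: n => [|n IH] Ff.
  by have := F0; congr F; apply/funext => x; rewrite big_ord0.
have := F_lincomb (c n) (Ff _ (ltnSn n)) (IH (fun i ni => Ff _ (ltnW ni))).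
by congr F; apply/funext => x; rewrite big_ord_recr/= addrC.
Qed.

(** [F_large] provides a common zero [z] of the functionals found so far and some [g] in [F] with
    [g z != 0]. Subtracting from [g] its components along them does not change its value at [z], so
    the remainder [g'] is nonzero and [Q_gt0] allows normalizing it. *)
Lemma gram_schmidt n : exists f : nat -> E -> R, (forall i, F (f i)) /\
  forall i j, (i < n)%N -> (j < n)%N -> f i (Q (f j)) = (i == j)%:R.
Proof.
elim: n => [|n [f [Ff fE]]]; first by exists (fun _ _ => 0); split.
have [z fz [g Fg gz]] := F_large n (fun i => F_dual (Ff i)).
pose h x := \sum_(i < n) - g (Q (f i)) * f i x.
have Fh : F h by exact: (@F_sum n (fun i => - g (Q (f i))) f).
pose g' x := 1 * g x + h x.
have Fg' : F g' by exact: F_lincomb.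
have g'z : g' z != 0.
  by rewrite /g' /h big1 ?addr0 ?mul1r// => i _; rewrite fz ?mulr0.
have q0 := Q_gt0 Fg' g'z.
have g'f i : (i < n)%N -> g' (Q (f i)) = 0.
  move=> ni; rewrite /g' /h mul1r (bigD1 (Ordinal ni))//= fE// eqxx mulr1 big1.
    by rewrite addr0 subrr.
  move=> j ji; rewrite fE// (_ : (_ == _) = false) ?mulr0//.
  by apply/negbTE; apply: contra ji => /eqP ji; apply/eqP/val_inj.
pose c := (Num.sqrt (g' (Q g')))^-1.
(* The summand 0 puts [e] in the form handled by [F_lincomb], with the zero functional. *)
pose e x := c * g' x + 0.
have Fe : F e by exact: F_lincomb.
have ef i : (i < n)%N -> e (Q (f i)) = 0.
  by move=> ni; rewrite /e addr0 g'f ?mulr0.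
have ee : e (Q e) = 1.
  rewrite /e addr0 (Q_sym (F_dual Fe) (F_dual Fg')) /e addr0 mulrA -expr2 /c exprVn.
  by rewrite sqr_sqrtr ?(ltW q0)// mulVf// gt_eqF.
exists (fun i => if (i < n)%N then f i else e); split.
  by move=> i; case: ifP.
move=> i j; rewrite !ltnS => ni nj.
case: ltnP => i'; case: ltnP => j'.
- exact: fE.
- rewrite (Q_sym (F_dual Fe) (F_dual (Ff i))) ef// (_ : (i == j) = false)//.
  by apply/negbTE; rewrite neq_ltn (leq_trans i' j').
- rewrite ef// (_ : (i == j) = false)//.
  by apply/negbTE; rewrite neq_ltn (leq_trans j' i') orbT.
- by rewrite ee (_ : i == j)//; apply/eqP/anti_leq; rewrite (leq_trans ni j') (leq_trans nj i').
Qed.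

End gram_schmidt.

(** * Variance of exponential means *)

Section exponential_mean.
Context {R : realType} {E H : completeNormedModType R}.
Variable ip : {dot H for (idfun : R -> R)}.
Hypothesis ip_norm : forall h : H, `|h| ^+ 2 = ip h h.
Variable S : R -> {linear E -> E}.
Hypothesis S_C0 : C0_semigroup S.
Variable B : {linear H -> E}.
Hypothesis B_continuous : continuous B.
Variable Q : R -> (E -> R) -> E.
Hypothesis Q_covariance : forall r : R, 0 <= r -> is_covariance ip B S r (Q r).
Variable mu : R -> probability (borel E) R.
Hypothesis mu_gaussian : forall r : R, 0 <= r -> centred_gaussian (mu r) (Q r).

Variables (n : nat) (f : nat -> E -> R) (r : R).
Hypothesis df : forall i, dual (f i).
Hypothesis r_ge0 : 0 <= r.

Definition exp_mean (y : E) : R := n.+1%:R^-1 * \sum_(i < n.+1) expR (f i y).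

Let C (i j : nat) : R := f j (Q r (f i)).
Let mi (i : nat) : R := expR (C i i / 2).
Definition exp_mean_expectation : R := n.+1%:R^-1 * \sum_(i < n.+1) mi i.

Let k : R := n.+1%:R^-1.
Let k0 : 0 < k. Proof. by rewrite invr_gt0. Qed.

Let measurable_exp g : dual g -> measurable_fun [set: borel E] (fun y : borel E => expR (g y)).
Proof.
move=> dg; apply: (measurableT_comp (@measurable_expR R)).
exact: borel_measurable_fun dg.2.
Qed.

Let C_sym i j : C i j = C j i.
Proof. exact: (covariance_sym ip_norm S_C0 B_continuous Q_covariance). Qed.

Let int_mean : (\int[mu r]_y (exp_mean y)%:E = exp_mean_expectation%:E)%E.
Proof.
rewrite /exp_mean; under eq_integral do rewrite EFinM -sumEFin.
rewrite ge0_integralZl_EFin ?(ltW k0)//; last 2 first.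
- by move=> y _; rewrite sume_ge0// => i _; rewrite lee_fin expR_ge0.
- by apply: emeasurable_sum => i; apply/measurable_EFinP; exact: measurable_exp.
rewrite ge0_integral_sum//; last first.
  by move=> i; apply/measurable_EFinP; exact: measurable_exp.
rewrite /exp_mean_expectation EFinM -sumEFin; congr (_ * _)%E; apply: eq_bigr => i _.
exact: (mu_mgf ip_norm S_C0 B_continuous Q_covariance mu_gaussian).
Qed.

Let int_sqr : (\int[mu r]_y (exp_mean y ^+ 2)%:E =
  (k ^+ 2 * \sum_(i < n.+1) \sum_(j < n.+1) mi i * mi j * expR (C i j))%:E)%E.
Proof.
have expand y : exp_mean y ^+ 2 =
    k ^+ 2 * \sum_(i < n.+1) \sum_(j < n.+1) expR (1 * f i y + f j y).
  rewrite /exp_mean -/k exprMn; congr (_ * _); rewrite expr2 mulr_suml.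
  apply: eq_bigr => i _; rewrite mulr_sumr; apply: eq_bigr => j _.
  by rewrite mul1r expRD.
under eq_integral do rewrite expand EFinM -sumEFin.
rewrite ge0_integralZl_EFin ?sqr_ge0//; last 2 first.
- move=> y _; apply: sume_ge0 => i _; rewrite lee_fin; apply: sumr_ge0 => j _.
  exact: expR_ge0.
- apply: emeasurable_sum => i; apply/measurable_EFinP; apply: measurable_sum => j.
  by apply: measurable_exp; exact: dual_lincomb.
rewrite [RHS]EFinM; congr (_ * _)%E.
rewrite ge0_integral_sum//; last 2 first.
- move=> i; apply/measurable_EFinP; apply: measurable_sum => j.
  by apply: measurable_exp; exact: dual_lincomb.
- by move=> i y _; rewrite lee_fin sumr_ge0// => j _; exact: expR_ge0.
rewrite -sumEFin; apply: eq_bigr => i _.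
under eq_integral do rewrite -sumEFin.
rewrite ge0_integral_sum//; last first.
  by move=> j; apply/measurable_EFinP; apply: measurable_exp; exact: dual_lincomb.
rewrite -sumEFin; apply: eq_bigr => j _.
rewrite (mu_mgf ip_norm S_C0 B_continuous Q_covariance mu_gaussian r_ge0
  (dual_lincomb 1 (df i) (df j))).
rewrite (covariance_lincomb ip_norm S_C0 B_continuous Q_covariance)//.
rewrite /mi -!expRD; congr (expR _)%:E; rewrite -/(C i i) -/(C j j) -/(C j i) (C_sym j i);
by field.
Qed.

Hypothesis C_diag : forall i, (i <= n)%N -> C i i <= 1.
Hypothesis C_row : forall i, (i <= n)%N -> \sum_(j < n.+1) C i j ^+ 2 <= 1.

(** The variance is the normalized double sum of [mi i * mi j * (expR (C i j) - 1)]. Each [mi] is at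
    most [expR 2^-1], and [expR c - 1 <= expR 1 * |c|] for [c <= 1], while
    [|c| <= eta + c ^+ 2 / eta]; the row bound then controls the sum of the squares. The bound is
    small when [eta] is chosen small first and [n] large afterwards. *)
Lemma exp_mean_variance (eta : R) : 0 < eta ->
  (\int[mu r]_y ((exp_mean y - exp_mean_expectation) ^+ 2)%:E <=
    (expR 2 * (eta + (n.+1%:R * eta)^-1))%:E)%E.
Proof.
move=> eta0; set m := exp_mean_expectation.
have mi0 i : 0 < mi i by exact: expR_gt0.
have m0 : 0 <= m.
  by rewrite mulr_ge0 ?(ltW k0)// sumr_ge0// => i _; rewrite ltW.
have mT : measurable_fun [set: borel E] (exp_mean : borel E -> R).
  by apply: measurable_funM => //; apply: measurable_sum => i; exact: measurable_exp.
have T0 y : 0 <= exp_mean y.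
  by rewrite mulr_ge0 ?(ltW k0)// sumr_ge0// => i _; exact: expR_ge0.
set D := (\int[mu r]_y _)%E.
(* The expansion of the square is arranged as [(T - m)^2 + 2 m T = T^2 + m^2], with [T] the
   exponential mean, so that only nonnegative functions are integrated. *)
have D_eq : (D + (2 * m * m)%:E =
    (k ^+ 2 * \sum_(i < n.+1) \sum_(j < n.+1) mi i * mi j * expR (C i j))%:E + (m ^+ 2)%:E)%E.
  rewrite -int_sqr [(2 * m * m)%:E]EFinM -int_mean.
  have -> : (m ^+ 2)%:E = (\int[mu r]_y (m ^+ 2)%:E)%E.
    by rewrite integral_cst//= probability_setT mule1.
  rewrite -ge0_integralZl_EFin//; last 3 first.
  - by move=> y _; rewrite lee_fin.
  - exact/measurable_EFinP.
  - by rewrite mulr_ge0.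
  have mT2 : measurable_fun [set: borel E] (fun y : borel E => (exp_mean y ^+ 2)%:E).
    by apply/measurable_EFinP; exact: measurable_funX.
  have mD : measurable_fun [set: borel E] (fun y : borel E => ((exp_mean y - m) ^+ 2)%:E).
    by apply/measurable_EFinP; apply: measurable_funX; exact: measurable_funB.
  have mL : measurable_fun [set: borel E] (fun y : borel E => ((2 * m)%:E * (exp_mean y)%:E)%E).
    by apply: measurable_funeM; exact/measurable_EFinP.
  have sq0 (g : borel E -> R) y : [set: borel E] y -> (0 <= (g y ^+ 2)%:E)%E.
    by move=> _; rewrite lee_fin sqr_ge0.
  have L0 y : [set: borel E] y -> (0 <= (2 * m)%:E * (exp_mean y)%:E)%E.
    by move=> _; rewrite -EFinM lee_fin; apply: mulr_ge0 (T0 y); exact: mulr_ge0.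
  have c0 (y : borel E) : [set: borel E] y -> (0 <= (m ^+ 2)%:E)%E.
    by move=> _; rewrite lee_fin sqr_ge0.
  have mE : measurable [set: borel E] by exact: measurableT.
  have eL := ge0_integralD (mu r) mE (sq0 (fun y => exp_mean y - m)) mD L0 mL.
  have eR := ge0_integralD (mu r) mE (sq0 exp_mean) mT2 c0 (measurable_cst (m ^+ 2)%:E).
  rewrite /D -eL -eR; apply: eq_integral => y _.
  by rewrite -EFinM -!EFinD; congr EFin; rewrite /cst; ring.
have m2 : m ^+ 2 = k ^+ 2 * \sum_(i < n.+1) \sum_(j < n.+1) mi i * mi j.
  rewrite /m /exp_mean_expectation -/k exprMn; congr (_ * _); rewrite expr2 mulr_suml.
  by apply: eq_bigr => i _; rewrite mulr_sumr.
have DE : D = (k ^+ 2 * \sum_(i < n.+1) \sum_(j < n.+1) mi i * mi j * (expR (C i j) - 1))%:E.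
  move: D_eq => /(congr1 (fun x => x - (2 * m * m)%:E)%E).
  rewrite addeK// => ->; rewrite -EFinD. congr EFin.
  have -> : \sum_(i < n.+1) \sum_(j < n.+1) mi i * mi j * (expR (C i j) - 1) =
    \sum_(i < n.+1) \sum_(j < n.+1) mi i * mi j * expR (C i j) -
    \sum_(i < n.+1) \sum_(j < n.+1) mi i * mi j.
    rewrite -sumrB; apply: eq_bigr => i _; rewrite -sumrB; apply: eq_bigr => j _; ring.
  by rewrite mulrBr -m2; ring.
rewrite DE lee_fin.
have C1 i j : (i <= n)%N -> (j <= n)%N -> `|C i j| <= 1.
  move=> ni nj; have := C_row ni; rewrite (bigD1 (Ordinal (nj : (j < n.+1)%N)))//=.
  set rest := \sum_(_ < _ | _) _ => h.
  have rest0 : 0 <= rest by apply: sumr_ge0 => l _; exact: sqr_ge0.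
  rewrite -(@ler_pXn2r _ 2)// ?nnegrE// expr1n real_normK ?num_real//; lra.
have term i j : (i <= n)%N -> (j <= n)%N ->
    mi i * mi j * (expR (C i j) - 1) <= expR 2 * (eta + C i j ^+ 2 / eta).
  move=> ni nj; have mi1 l : (l <= n)%N -> mi l <= expR 2^-1.
    by move=> nl; rewrite ler_expR; have := C_diag nl; lra.
  have e1 : expR (C i j) - 1 <= expR 1 * `|C i j|.
    have [c0|c0] := leP 0 (C i j).
      rewrite ger0_norm//; have c1 : C i j <= 1 by have := C1 _ _ ni nj; rewrite ger0_norm.
      (* From [1 - c <= expR (- c)] one gets [expR c - 1 <= c * expR c]. *)
      have h := expR_ge1Dx (- C i j); rewrite expRN in h.
      have p := expR_gt0 (C i j).
      have : (1 - C i j) * expR (C i j) <= 1.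
        by rewrite -ler_pdivlMr// mul1r.
      have : C i j * expR (C i j) <= C i j * expR 1 by rewrite ler_wpM2l// ler_expR.
      lra.
    apply: (@le_trans _ _ 0); last by apply: mulr_ge0 => //; exact: expR_ge0.
    by rewrite subr_le0 -[leRHS]expR0 ler_expR ltW.
  have e2 : `|C i j| <= eta + C i j ^+ 2 / eta.
    rewrite -(ler_pM2r eta0) mulrDl divfK ?gt_eqF// -[C i j ^+ 2]real_normK ?num_real//.
    have := sqr_ge0 (eta - `|C i j|); have := sqr_ge0 eta; have := sqr_ge0 `|C i j|; nra.
  have -> : expR 2 = (expR 2^-1 * expR 2^-1) * expR 1 :> R.
    by rewrite -!expRD; congr expR; field.
  apply: (@le_trans _ _ (mi i * mi j * (expR 1 * `|C i j|))).
    by rewrite ler_wpM2l// mulr_ge0// ltW.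
  rewrite -[leRHS]mulrA; apply: ler_pM.
  - by rewrite mulr_ge0// ltW.
  - by rewrite mulr_ge0// expR_ge0.
  - by apply: ler_pM; rewrite ?(ltW (mi0 _))//; exact: mi1.
  - by rewrite ler_wpM2l// expR_ge0.
apply: (@le_trans _ _ (k ^+ 2 * \sum_(i < n.+1) (expR 2 * (n.+1%:R * eta + eta^-1)))).
  rewrite ler_wpM2l ?sqr_ge0//; apply: ler_sum => i _.
  have ni : (i <= n)%N by rewrite -ltnS.
  apply: (@le_trans _ _ (\sum_(j < n.+1) expR 2 * (eta + C i j ^+ 2 / eta))).
    by apply: ler_sum => j _; apply: term => //; rewrite -ltnS.
  rewrite -mulr_sumr ler_wpM2l ?expR_ge0// big_split/= sumr_const card_ord mulr_natl lerD2l.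
  by rewrite -mulr_suml -[leRHS]mul1r ler_wpM2r ?invr_ge0 ?(ltW eta0)//; exact: C_row.
rewrite sumr_const card_ord -mulr_natl /k.
rewrite le_eqVlt; apply/orP; left; apply/eqP; field.
by rewrite gt_eqF//= pnatr_eq0.
Qed.

End exponential_mean.

(** By convexity the increment of the exponential is at most its slope at the larger truncated
    argument, which does not exceed [expR M]. *)
Lemma expR_min_lipschitz (R : realType) (M a b : R) :
  `|expR (Num.min a M) - expR (Num.min b M)| <= expR M * `|a - b|.
Proof.
wlog ab : a b / a <= b.
  move=> h; have [/h//|/ltW/h] := leP a b.
  by rewrite distrC (distrC a b).
have mab : Num.min a M <= Num.min b M by rewrite le_min ge_min ab ge_min lexx orbT.
rewrite ler0_norm ?subr_le0 ?ler_expR// opprB ler0_norm ?subr_le0// opprB.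
set u := Num.min a M in mab *; set v := Num.min b M in mab *.
have vM : v <= M by rewrite ge_min lexx orbT.
have uv : v - u <= b - a.
  rewrite /u /v; have [aM|aM] := leP a M; have [bM|bM] := leP b M; lra.
apply: (@le_trans _ _ (expR v * (v - u))); last first.
  by apply: ler_pM => //; rewrite ?expR_ge0 ?subr_ge0 ?ler_expR.
have := expR_ge1Dx (u - v); rewrite expRD expRN.
have v0 := expR_gt0 v; rewrite -(ler_pM2l v0) mulrCA divff ?gt_eqF// mulr1; lra.
Qed.

Section orthonormal.
Context {R : realType} {E H : completeNormedModType R}.
Variable ip : {dot H for (idfun : R -> R)}.
Hypothesis ip_norm : forall h : H, `|h| ^+ 2 = ip h h.
Variable S : R -> {linear E -> E}.
Hypothesis S_C0 : C0_semigroup S.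
Variable B : {linear H -> E}.
Hypothesis B_continuous : continuous B.
Variable Q : R -> (E -> R) -> E.
Hypothesis Q_covariance : forall r : R, 0 <= r -> is_covariance ip B S r (Q r).
Variable mu : R -> probability (borel E) R.
Hypothesis mu_gaussian : forall r : R, 0 <= r -> centred_gaussian (mu r) (Q r).
Variables (s t : R).
Hypothesis s_ge0 : 0 <= s.
Hypothesis s_le_t : s <= t.
Hypothesis norm_lt2 : (opnorm (BUCo S mu) (fun f => OU S mu t f \- OU S mu s f)%R
             < 2%:E)%E.

Let t_ge0 : 0 <= t. Proof. exact: le_trans s_le_t. Qed.

(** Bessel-type inequality. Let [v] be the combination of the [f j] with coefficients
    [c j = f j (Q s (f i))]. The sum of squares [A] equals both the [Q s]-pairing of [v] with [f i]
    and the [Q t]-variance of [v], so the [Q s]-variance of [f i - v] is at most [1 - 2 A + A]. *)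
Let gram_row_le1 n (f : nat -> E -> R) i : (forall i, dual (f i)) ->
  (forall i j, (i < n)%N -> (j < n)%N -> f i (Q t (f j)) = (i == j)%:R) ->
  (i < n)%N -> \sum_(j < n) f j (Q s (f i)) ^+ 2 <= 1.
Proof.
move=> df fE ni.
pose c j := f j (Q s (f i)).
pose v x := \sum_(j < n) c j * f j x.
have dv : dual v by exact: dual_sum.
have sym r g h := covariance_sym (r := r) ip_norm S_C0 B_continuous Q_covariance (f := g) (g := h).
set A := \sum_(j < n) _.
have vsf : v (Q s (f i)) = A by apply: eq_bigr => j _; rewrite /c expr2.
have vtv : v (Q t v) = A.
  rewrite /v; apply: eq_bigr => j _; rewrite -(sym t) ?dv// /v.
  rewrite (bigD1 j)//= fE// eqxx mulr1 big1 ?addr0 ?expr2// => l lj.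
  rewrite fE// (_ : (_ == _) = false) ?mulr0//.
  by apply/negbTE; apply: contra lj => /eqP lj; apply/eqP/val_inj.
have mono g : dual g -> g (Q s g) <= g (Q t g).
  apply: (covariance_nondecreasing ip_norm S_C0 B_continuous Q_covariance).
  by rewrite s_ge0.
(* [Q s] is nonnegative on [f i - v] and at most [Q t] on [v] *)
have dd := dual_lincomb (-1) dv (df i).
have := covariance_ge0 ip_norm S_C0 B_continuous Q_covariance s_ge0 dd.
rewrite (covariance_lincomb ip_norm S_C0 B_continuous Q_covariance)// vsf.
have fii : f i (Q t (f i)) = 1 by rewrite fE// eqxx.
by have := mono _ dv; rewrite vtv; have := mono _ (df i); rewrite fii; lra.
Qed.

Lemma no_large_orthonormal_family (theta : R) : 0 < theta < 1 ->
  ~ (forall n, exists f : nat -> E -> R, [/\ forall i, dual (f i),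
    forall i j, (i < n)%N -> (j < n)%N -> f i (Q t (f j)) = (i == j)%:R &
    forall i, (i < n)%N -> f i (Q s (f i)) <= theta]).
Proof.
move=> /andP[th0 th1] many.
have [e e0 sep] := cylindrical_not_separated ip_norm S_C0 B_continuous Q_covariance
  mu_gaussian s_ge0 t_ge0 norm_lt2.
pose m1 : R := expR 2^-1; pose rho : R := expR (theta / 2).
have m1rho : 0 < m1 - rho by rewrite subr_gt0 ltr_expR; lra.
(* The affine map [u |-> al * (u - be)] sends [m1] to 2 and [rho] to -2. After clamping at 1 and -1,
   an error therefore requires a deviation of at least [al^-1] from the mean. *)
pose al := 4 / (m1 - rho); pose be := (m1 + rho) / 2.
have al0 : 0 < al by rewrite divr_gt0.
have alm1 : al * (m1 - be) = 2 by rewrite /al /be; field; rewrite gt_eqF.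
have alrho : al * (rho - be) = - 2 by rewrite /al /be; field; rewrite gt_eqF.
(* The two Chebyshev bounds add up to [K * eta + K / (n.+1%:R * eta)]; [eta] makes the first term
   equal to [e / 4], and then [n] makes the second smaller than [e / 4]. *)
pose K : R := 4 * al ^+ 2 * expR 2.
have K0 : 0 < K by rewrite mulr_gt0 ?expR_gt0// mulr_gt0// exprn_gt0.
pose eta := e / (4 * K).
have eta0 : 0 < eta by rewrite divr_gt0// mulr_gt0.
pose n := Num.truncn (4 * K / (eta * e)).
have nK : 4 * K / (eta * e) < n.+1%:R by exact: truncnS_gt.
have [f [df fE fth]] := many n.+1.
(* Truncating the exponentials at [M] makes the mean Lipschitz; [M] is such that the
   truncation has an effect only where [G] is 1 anyway. *)
pose M : R := n.+1%:R * (be + al^-1).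
pose TM (z : E) : R := n.+1%:R^-1 * \sum_(i < n.+1) expR (Num.min (f i z) M).
pose T := exp_mean n f.
pose G z := clamp (al * (TM z - be)).
have n0 : 0 < n.+1%:R^-1 :> R by rewrite invr_gt0.
have TM_T z : TM z <= T z.
  rewrite ler_pM2l//; apply: ler_sum => i _.
  by rewrite ler_expR ge_min lexx.
have TM_big z : TM z = T z \/ 1 <= al * (TM z - be).
  have [[i [ni fM]]|noM] := pselect (exists i, (i < n.+1)%N /\ M < f i z); last first.
    left; congr (_ * _); apply: eq_bigr => i _; rewrite (min_idPl _)// leNgt.
    by apply/negP => h; apply: noM; exists i.
  right; rewrite mulrC -ler_pdivrMr// mul1r lerBrDl -(ler_pM2l (_ : 0 < n.+1%:R))//.
  rewrite /TM mulrA divff ?mul1r ?pnatr_eq0//.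
  (* A single truncated term already contributes [expR M >= M], and [M / n.+1%:R = be + al^-1]. *)
  apply: (@le_trans _ _ (expR M)); first by apply: le_trans (expR_ge1Dx M); rewrite lerDr.
  rewrite (bigD1 (Ordinal ni))//= (min_idPr (ltW fM)) lerDl.
  by apply: sumr_ge0 => j _; exact: expR_ge0.
have Gcyl : cylindrical_lipschitz G.
  exists n.+1, (fun i z => (al * n.+1%:R^-1 * expR M) * f i z).
    by move=> i; exact: dualMl.
  move=> x y; apply: (le_trans (clamp_lipschitz _ _)).
  rewrite (_ : _ - _ = al * n.+1%:R^-1 * \sum_(i < n.+1)
    (expR (Num.min (f i x) M) - expR (Num.min (f i y) M))); last first.
    by rewrite sumrB /TM; ring.
  have c1 : 0 < al * n.+1%:R^-1 by exact: mulr_gt0.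
  rewrite normrM (gtr0_norm c1).
  have c0 : 0 < al * n.+1%:R^-1 * expR M.
    by apply: mulr_gt0; [exact: mulr_gt0|exact: expR_gt0].
  under [leRHS]eq_bigr do rewrite normrM (gtr0_norm c0).
  rewrite -mulr_sumr -[leRHS]mulrA (ler_pM2l c1) mulr_sumr.
  apply: (le_trans (ler_norm_sum _ _ _)); apply: ler_sum => i _.
  by rewrite (dualB (df i)); exact: expR_min_lipschitz.
have mt : exp_mean_expectation Q n f t = m1.
  rewrite /exp_mean_expectation (eq_bigr (fun=> m1)); last first.
    by move=> i _; rewrite fE// eqxx div1r.
  by rewrite sumr_const card_ord -[m1 *+ _]mulr_natl mulrA mulVf ?mul1r ?pnatr_eq0.
have ms : exp_mean_expectation Q n f s <= rho.
  rewrite /exp_mean_expectation ler_pdivrMl//.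
  have -> : n.+1%:R * rho = \sum_(i < n.+1) rho by rewrite sumr_const card_ord mulr_natl.
  apply: ler_sum => i _; rewrite ler_expR ler_pM2r ?invr_gt0//; exact: fth.
(* Pointwise Chebyshev inequality: the left side is at most 2, and it vanishes unless [T z] lies at
   least [al^-1] below [m1]. *)
have upper z : 1 - G z <= 2 * al ^+ 2 * (T z - m1) ^+ 2.
  have sq := sqr_ge0 (al * (T z - m1)).
  have [TT|h] := TM_big z; last first.
    by rewrite /G clamp_ge1// subrr -mulrA -exprMn mulr_ge0.
  rewrite /G TT; have [h|h] := leP 1 (al * (T z - be)).
    by rewrite clamp_ge1// subrr -mulrA -exprMn mulr_ge0.
  have := clamp_norm_le1 (al * (T z - be)); rewrite ler_norml => /andP[c1 _].
  have : 1 <= al * (m1 - T z) by move: alm1 h; rewrite !mulrBr; lra.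
  move=> h1; have : 1 <= (al * (m1 - T z)) ^+ 2 by rewrite exprn_ege1.
  rewrite exprMn -[m1 - _]opprB sqrrN => h2.
  by rewrite -mulrA; lra.
(* Here truncation only helps, since [TM <= T] and [clamp] is monotone; as the mean under [mu s] is
   at most [rho], the deviation needed is again at least [al^-1]. *)
have lower z : 1 + G z <= 2 * al ^+ 2 * (T z - exp_mean_expectation Q n f s) ^+ 2.
  apply: (@le_trans _ _ (1 + clamp (al * (T z - be)))).
    by rewrite lerD2l; apply: clamp_homo; rewrite ler_pM2l// lerD2r.
  set m := exp_mean_expectation _ _ _ _ in ms *.
  have sq := sqr_ge0 (al * (T z - m)).
  have [h|h] := leP (al * (T z - be)) (-1).
    by rewrite clamp_leN1// subrr -mulrA -exprMn mulr_ge0.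
  have := clamp_norm_le1 (al * (T z - be)); rewrite ler_norml => /andP[_ c1].
  have h0 : al * m <= al * rho by rewrite ler_pM2l.
  have h1 : 1 <= al * (T z - m) by move: alrho h; rewrite !mulrBr; lra.
  have : 1 <= (al * (T z - m)) ^+ 2 by rewrite exprn_ege1.
  rewrite exprMn => h2.
  by rewrite -mulrA; lra.
pose V := expR 2 * (eta + (n.+1%:R * eta)^-1) : R.
have vt : (\int[mu t]_y ((T y - m1) ^+ 2)%:E <= V%:E)%E.
  rewrite -mt; apply: (exp_mean_variance ip_norm S_C0 B_continuous Q_covariance) => //.
  - by move=> i ni; rewrite fE// eqxx.
  - move=> i ni; rewrite (bigD1 (Ordinal (ni : (i < n.+1)%N)))//= fE// eqxx expr1n.
    rewrite big1 ?addr0// => j ji; rewrite fE// (_ : (_ == _) = false) ?expr0n//.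
    by apply/negbTE; apply: contra ji => /eqP ji; apply/eqP/val_inj.
have vs : (\int[mu s]_y ((T y - exp_mean_expectation Q n f s) ^+ 2)%:E <= V%:E)%E.
  apply: (exp_mean_variance ip_norm S_C0 B_continuous Q_covariance) => //.
  - by move=> i ni; apply: (le_trans (fth i ni)); exact: ltW.
  - by move=> i ni; exact: gram_row_le1.
have mT : measurable_fun [set: borel E] (T : borel E -> R).
  apply: measurable_funM => //; apply: measurable_sum => i.
  apply: (measurableT_comp (@measurable_expR R)); exact: borel_measurable_fun (df i).2.
have mG : measurable_fun [set: borel E] (G : borel E -> R).
  have [L L0 GL] := cylindrical_lipschitz_bound Gcyl.
  by apply: borel_measurable_fun; exact: lipschitz_continuous L0 GL.
have Gn z : `|G z| <= 1 by exact: clamp_norm_le1.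
have bound r m (g : E -> R) : measurable_fun [set: borel E] (g : borel E -> R) ->
    (forall z, 0 <= g z <= 2 * al ^+ 2 * (T z - m) ^+ 2) ->
    (\int[mu r]_y ((T y - m) ^+ 2)%:E <= V%:E)%E ->
    (\int[mu r]_y (g y)%:E <= (2 * al ^+ 2 * V)%:E)%E.
  move=> mg gle rV; have al2 : 0 <= 2 * al ^+ 2 by rewrite mulr_ge0// sqr_ge0.
  have mTm : measurable_fun [set: borel E] (fun y : borel E => ((T y - m) ^+ 2)%:E).
    by apply/measurable_EFinP; apply: measurable_funX; exact: measurable_funB.
  have Tm0 (y : borel E) : [set: borel E] y -> (0 <= ((T y - m) ^+ 2)%:E)%E.
    by move=> _; rewrite lee_fin sqr_ge0.
  apply: (@le_trans _ _ (\int[mu r]_y ((2 * al ^+ 2)%:E * ((T y - m) ^+ 2)%:E))%E).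
    apply: ge0_le_integral => //.
    - by move=> y _; rewrite lee_fin; have /andP[] := gle y.
    - exact/measurable_EFinP.
    - exact: measurable_funeM.
    - by move=> y _; rewrite -EFinM lee_fin; have /andP[] := gle y.
  rewrite ge0_integralZl_EFin// [leRHS]EFinM.
  by apply: lee_wpmul2l => //; rewrite lee_fin.
have : e <= 2 * al ^+ 2 * V + 2 * al ^+ 2 * V.
  (* Starting from the point 0 compares the centred measures [mu t] and [mu s] themselves. *)
  apply: (sep G Gcyl Gn 0); rewrite raddf0.
    under eq_integral do rewrite add0r.
    apply: (bound t m1) => // [|z]; first exact: measurable_funB.
    by rewrite upper andbT; have := Gn z; rewrite ler_norml; lra.
  under eq_integral do rewrite add0r.
  apply: (bound s _ _ _ _ vs) => // [|z]; first exact: measurable_funD.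
  by rewrite lower andbT; have := Gn z; rewrite ler_norml; lra.
apply/negP; rewrite -ltNge.
rewrite (_ : _ + _ = K * eta + K / (n.+1%:R * eta)); last by rewrite /V /K; ring.
have -> : K * eta = e / 4 by rewrite /eta; field; rewrite gt_eqF.
have p1 : 0 < n.+1%:R * eta by exact: mulr_gt0.
have p2 : 0 < eta * e by exact: mulr_gt0.
have : K / (n.+1%:R * eta) < e / 4.
  rewrite (ltr_pdivrMr _ _ p1); move: nK; rewrite (ltr_pdivrMr _ _ p2).
  have -> : e / 4 * (n.+1%:R * eta) = n.+1%:R * (eta * e) / 4 by ring.
  by move=> h; rewrite ltr_pdivlMr// mulrC.
move=> h; apply: (@lt_le_trans _ _ (e / 4 + e / 4)); first by rewrite ltrD2l.
move: (e) e0 => x x0; lra.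
Qed.

End orthonormal.

(** * Nondegeneracy on invariant functionals *)

Lemma closed_linear_kernel (R : realType) (E F : normedModType R) (T : {linear E -> F}) :
  continuous T -> closed_subspace [set x | T x = 0].
Proof.
move=> cT; split.
  rewrite (_ : mkset _ = T @^-1` [set 0])//.
  apply: closed_comp => [x _|]; first exact: cT.
  by apply: accessible_closed_set1; apply: hausdorff_accessible; exact: norm_hausdorff.
split; first by rewrite inE /= raddf0.
by move=> a x y; rewrite !inE /= => Tx Ty; rewrite linearP Tx Ty scaler0 addr0.
Qed.

Section nondegeneracy.
Context {R : realType} {E : completeNormedModType R}.
Variable S : R -> {linear E -> E}.
Variable mu : R -> probability (borel E) R.
Variables (Q : (E -> R) -> E) (p : R).
Hypothesis mu_gaussian : centred_gaussian (mu p) Q.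
Implicit Types f : E -> R.

Let level_dirac f c : dual f -> f (Q f) = 0 ->
  mu p (f @^-1` [set c]) = dirac (0 : R) [set c].
Proof.
move=> df f0; have := mu_gaussian df (measurable_set1 c).
by rewrite f0 /centred_normal eqxx.
Qed.

(** A functional of variance 0 has a Dirac law at 0, so its kernel is a closed subspace of full
    measure. *)
Lemma nondegenerate_covariance_eq0 f : nondegenerate_measure (mu p) ->
  dual f -> f (Q f) = 0 -> forall x, f x = 0.
Proof.
move=> nondeg df f0 x; have [g fg] := dualP df.
have : [set x | f x = 0] = setT.
  apply: nondeg; last first.
    by apply: (etrans (level_dirac 0 df f0)); rewrite diracE mem_set.
  rewrite fg; apply: (@closed_linear_kernel R E R^o).
  by rewrite -fg; exact: df.2.
by move/seteqP => [_ /(_ x Logic.I)].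
Qed.

(** With variance 0 and invariance under [S p], the Ornstein-Uhlenbeck operator at time [p] fixes
    the indicator of the kernel of [f]. This indicator is continuous only if [f] is zero. *)
Lemma Feller_covariance_eq0 f : strongly_Feller S mu p -> f \o S p = f ->
  dual f -> f (Q f) = 0 -> forall x, f x = 0.
Proof.
move=> feller fS df f0 x.
have mf : measurable_fun [set: borel E] (f : borel E -> R) := borel_measurable_fun df.2.
have mlevel c : measurable (f @^-1` [set c] : set (borel E)).
  by rewrite -[X in measurable X]setTI; apply: mf => //; exact: measurable_set1.
pose g : E -> R := \1_(f @^-1` [set 0]).
have gB : Bb g.
  split.
    apply: (@bounded_on_by _ _ _ _ 1) => y _; rewrite /g indicE.
    by case: (_ \in _); rewrite ?normr0 ?normr1.
  exact: measurable_indic.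
have gE y : OU S mu p g y = (f y == 0)%:R.
  rewrite /OU /Rintegral.
  rewrite (_ : (fun z : borel E => (g (S p y + (z : E)))%:E) =
    (fun z : borel E => (\1_(f @^-1` [set - f y]) z)%:E)); last first.
    apply/funext => z; rewrite /g !indicE; congr (nat_of_bool _)%:R%:E.
    have fy : f (S p y) = f y by rewrite -[LHS]/((f \o S p) y) fS.
    apply/idP/idP; rewrite !inE /= dualD// fy => h; lra.
  rewrite integral_indic// setIT.
  transitivity (fine (dirac (0 : R) [set - f y] : \bar R)).
    by congr fine; exact: level_dirac.
  rewrite diracE/=; congr (nat_of_bool _)%:R.
  by apply/idP/idP => [|/eqP]; rewrite inE /= => h; [apply/eqP|]; lra.
apply/eqP/negPn/negP => fx.
have [_ /(_ 0)/cvgrPdist_lt/(_ 1 ltr01)] := feller g gB.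
rewrite gE dual0// eqxx => /nbhs_norm0P [d /= d0 dP].
have x0 : 0 < `|x|.
  by rewrite normr_gt0; apply/eqP => x0; move: fx; rewrite x0 dual0// eqxx.
(* This multiple of [x] has norm [d / 2] and [f] does not vanish at it, so the indicator jumps by 1
   arbitrarily close to 0. *)
have := dP ((d / (2 * `|x|)) *: x); rewrite gE (dualZ _ _ df).
have c0 : 0 < d / (2 * `|x|) by rewrite divr_gt0// mulr_gt0.
rewrite mulf_eq0 (negbTE fx) gt_eqF//= subr0 normr1 ltxx => h.
suff : false by []. 
apply: h; rewrite /= normrZ gtr0_norm// invfM mulrA divfK ?gt_eqF//; lra.
Qed.

End nondegeneracy.

(** * The decomposition *)

Theorem theorem2p11 (R : realType) (E H : completeNormedModType R)
  (ip : {dot H for (idfun : R -> R)})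
  (ip_norm : forall h : H, `|h| ^+ 2 = ip h h)
  (S : R -> {linear E -> E}) (S_C0 : C0_semigroup S)
  (B : {linear H -> E}) (B_continuous : continuous B)
  (Q : R -> (E -> R) -> E)
  (Q_covariance : forall r : R, 0 <= r -> is_covariance ip B S r (Q r))
  (mu : R -> probability (borel E) R)
  (mu_radon : forall r : R, 0 <= r -> radon (mu r))
  (mu_gaussian : forall r : R, 0 <= r -> centred_gaussian (mu r) (Q r))
  (s t : R) (s_ge0 : 0 <= s) (s_lt_t : s < t)
  (norm_lt2 : (opnorm (BUCo S mu) (fun f => OU S mu t f \- OU S mu s f)%R
             < 2%:E)%E)
  (nondegenerate_or_Feller :
    nondegenerate_measure (mu (t - s)) \/ strongly_Feller S mu (t - s)) :
  exists E0 E1 : set E,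
    [/\ topological_direct_sum E0 E1,
        semigroup_invariant S E0 /\ semigroup_invariant S E1,
        finite_dimensional E1,
        nilpotent_on S E0 &
        periodic_on S E1 (t - s)].
Proof.
have t_ge0 : 0 <= t := le_trans s_ge0 (ltW s_lt_t).
have STs x : S t x = S s x.
  exact: (semigroup_agree ip_norm S_C0 B_continuous Q_covariance mu_gaussian s_ge0 t_ge0).
set p := t - s in nondegenerate_or_Feller *.
have p0 : 0 < p by rewrite subr_gt0.
have p_ge0 := ltW p0.
have SD := semigroupD S_C0.
have S_shift u x : s <= u -> S (u + p) x = S u x.
  move=> su; have -> : u + p = (u - s) + t by rewrite /p; ring.
  by rewrite SD ?subr_ge0// STs -SD ?subr_ge0// subrK.
(* [k.+1] exceeds [s / p], so the multiple [N] of [p] is at least [s], and from time [s] on [S] is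
   unchanged by adding multiples of [p]. *)
pose k := Num.truncn (s / p).
pose N : R := k.+1%:R * p.
have sN : s <= N by rewrite -ler_pdivrMr// ltW// truncnS_gt.
have N0 : 0 <= N := le_trans s_ge0 sN.
have S_shiftn u m x : s <= u -> S (u + m%:R * p) x = S u x.
  move=> su; elim: m => [|m IH]; first by rewrite mul0r addr0.
  rewrite -natr1 mulrDl mul1r addrA S_shift// (le_trans su)// lerDl.
  by rewrite mulr_ge0.
have PP x : S N (S N x) = S N x by rewrite -SD// S_shiftn.
have SpN x : S p (S N x) = S N x by rewrite -SD// addrC S_shift.
have SNp x : S N (S p x) = S N x by rewrite -SD// S_shift.
have S_comm u x : 0 <= u -> S N (S u x) = S u (S N x) by move=> u0; rewrite -!SD// addrC.
have cN : continuous (S N) by exact: (semigroup_bounded S_C0).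
pose proj : {linear E -> E} := idfun \- S N.
have cproj : continuous proj by move=> x; apply: cvgB; [exact: cvg_id|exact: cN].
have E1E : [set x | S N x = x] = [set x | proj x = 0].
  apply/seteqP; split => x /= h; first by rewrite /= h subrr.
  by apply/esym/eqP; rewrite -subr_eq0; apply/eqP.
have E1closed : closed_subspace [set x | S N x = x].
  by rewrite E1E; exact: closed_linear_kernel.
exists [set x | S N x = 0], [set x | S N x = x]; split.
- split => //; first exact: closed_linear_kernel.
    apply/seteqP; split => [x [/= -> ->]//|_ ->]; split; exact: raddf0.
  exists proj; split => // x; split => /=.
    by rewrite raddfB/= PP subrr.
  by rewrite opprB addrCA subrr addr0 PP.
- by split => u x u0 /= Nx; rewrite S_comm// Nx// raddf0.
- apply: contrapT => infin.
  pose F : set (E -> R) := [set f | dual f /\ f \o S p = f].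
  have F_dual f : F f -> dual f by case.
  have F_lincomb a f g : F f -> F g -> F (fun x => a * f x + g x).
    move=> [df fS] [dg gS]; split; first exact: dual_lincomb.
    apply/funext => x /=; rewrite -[f (S p x)]/((f \o S p) x) -[g (S p x)]/((g \o S p) x).
    by rewrite fS gS.
  have F0 : F (fun=> 0) by split => //; exact: dual_cst0.
  have sym := covariance_sym ip_norm S_C0 B_continuous Q_covariance.
  have ge0 := covariance_ge0 ip_norm S_C0 B_continuous Q_covariance.
  have Q_t f : F f -> f (Q t f) = f (Q s f) + f (Q p f).
    move=> [df fS].
    rewrite -(covariance_periodic ip_norm S_C0 B_continuous Q_covariance)//.
    by rewrite /p addrC subrK.
  have Q_gt0 f x : F f -> f x != 0 -> 0 < f (Q t f).
    move=> Ff; have [df fS] := Ff; apply: contraNT; rewrite -leNgt Q_t// => le0.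
    have f0 : f (Q p f) = 0.
      by have := ge0 f s s_ge0 df; have := ge0 f p p_ge0 df; lra.
    apply/eqP; case: nondegenerate_or_Feller => h.
      by apply: (nondegenerate_covariance_eq0 (mu_gaussian p p_ge0) h df f0).
    exact: (Feller_covariance_eq0 (mu_gaussian p p_ge0) h fS df f0).
  (* If every functional in [F] vanished at the common zeros of finitely many functionals, these
     would separate the points of [E1], since any [g] agrees on [E1] with [g \o S N], which is in
     [F]; [E1] would then be finite-dimensional. *)
  have F_large n (f : nat -> E -> R) : (forall i, dual (f i)) ->
      exists2 z, (forall i, (i < n)%N -> f i z = 0) & exists2 g, F g & g z != 0.
    move=> df; apply: contrapT => nF; apply: infin.
    apply: (finite_dimensional_separated (n := n) df); rewrite /= ?raddf0//.
      by move=> a x y Nx Ny; rewrite linearP Nx Ny.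
    move=> z Nz fz; apply/eqP/negPn/negP => /hahn_banach_separation[g dg gz].
    apply: nF; exists z => //; exists (g \o S N); last by rewrite /= Nz.
    split; first exact: dual_comp.
    by apply/funext => x /=; rewrite SNp.
  have th : 0 < (k.+1%:R / k.+2%:R : R) < 1.
    by rewrite divr_gt0//= ltr_pdivrMr// mul1r ltr_nat.
  apply: (no_large_orthonormal_family ip_norm S_C0 B_continuous Q_covariance mu_gaussian
    s_ge0 (ltW s_lt_t) norm_lt2 th) => n.
  have [f [Ff fE]] := gram_schmidt (fun f g df dg => sym f g t t_ge0 df dg)
    F_dual F_lincomb F0 Q_gt0 F_large n.
  exists f; split => // [i|i ni]; first exact: F_dual.
  have [df fS] := Ff i; rewrite ler_pdivlMr//.
  have := Q_t _ (Ff i); rewrite fE// eqxx.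
  have := covariance_nondecreasing ip_norm S_C0 B_continuous Q_covariance
    (introT andP (conj s_ge0 sN)) df.
  rewrite (covariance_period_multiple ip_norm S_C0 B_continuous Q_covariance)//.
  (* Here [a] and [b] are the variances of [f i] for [Q s] and [Q p]: [a <= c * b] together with
     [a + b = 1] gives [a * (c + 1) <= c]. *)
  rewrite -[k.+2%:R]natr1; set a := f i _; set b := f i _; set c := k.+1%:R.
  move=> h1 h2; have hb : b = 1 - a by move: h2; rewrite /=; lra.
  by move: h1; rewrite hb; lra.
- by exists N => // x.
- by move=> x /= <-; rewrite SpN.
Qed.
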